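(* Let $A,B$ be rings, ${}_AN_B$ and ${}_BM_A$ bimodules, $\phi\colon M\otimes_AN\to B$ and $\psi\colon N\otimes_BM\to A$ bimodule homomorphisms defining a Morita context, and let $\Lambda=\Lambda_{(\phi,\psi)}=\begin{pmatrix}A & N\\ M & B\end{pmatrix}$ be the associated Morita ring, with idempotents $e=\begin{pmatrix}1_A & 0\\ 0 & 0\end{pmatrix}$ and $f=\begin{pmatrix}0 & 0\\ 0 & 1_B\end{pmatrix}$. (i) The ideal $\langle e\rangle=\Lambda e\Lambda$ is stratifying if and only if $\phi\colon M\otimes_AN\to B$ is a monomorphism and $\mathrm{Tor}^A_i(M,N)=0$ for all $i>0$. (ii) The ideal $\langle f\rangle=\Lambda f\Lambda$ is stratifying if and only if $\psi\colon N\otimes_BM\to A$ is a monomorphism and $\mathrm{Tor}^B_i(N,M)=0$ for all $i>0$.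
   Context: Morita context: $\phi$ is a $B$-$B$-bimodule map and $\psi$ an $A$-$A$-bimodule map with $\phi(m\otimes n)m'=m\psi(n\otimes m')$ and $n\phi(m\otimes n')=\psi(n\otimes m)n'$ for all $m,m'\in M$, $n,n'\in N$. The Morita ring $\Lambda_{(\phi,\psi)}$ is $A\oplus N\oplus M\oplus B$, written as $2\times 2$ matrices, with multiplication $\begin{pmatrix}a & n\\ m & b\end{pmatrix}\begin{pmatrix}a' & n'\\ m' & b'\end{pmatrix}=\begin{pmatrix}aa'+\psi(n\otimes m') & an'+nb'\\ ma'+bm' & bb'+\phi(m\otimes n')\end{pmatrix}$. For a ring $R$ with an idempotent $e$, the ideal $ReR$ is stratifying if the multiplication map $Re\otimes_{eRe}eR\to ReR$ is an isomorphism and $\mathrm{Tor}^{eRe}_i(Re,eR)=0$ for all $i>0$. *)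

(* Defs.v *)
(* Rings are unital and may be zero (pzRingType): a corner ring eRe is zero when
   e = 0. Subgroups are boolean predicates through the classical `[< _ >]. *)
From HB Require Import structures.
From mathcomp Require Import all_boot all_algebra.
From mathcomp Require Import finmap boolp.
From mathcomp.multinomials Require Import monalg.

Set Implicit Arguments.
Unset Strict Implicit.
Unset Printing Implicit Defensive.

Import GRing.Theory.
Local Open Scope ring_scope.

Reserved Notation "v *< a" (at level 40, left associativity).
Reserved Notation "m ⊗ n" (at level 40, left associativity).

HB.mixin Record Zmodule_isRmodule (R : pzRingType) V of GRing.Zmodule V := {
  ract : V -> R -> V;
  ractA : forall v a b, ract (ract v a) b = ract v (a * b);
  ractr1 : forall v, ract v 1 = v;
  ractDl : forall a, {morph ract^~ a : u v / u + v};
  ractDr : forall v, {morph ract v : a b / a + b}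
}.

#[short(type="rmodType")]
HB.structure Definition Rmodule (R : pzRingType) :=
  {V of GRing.Zmodule V & Zmodule_isRmodule R V}.

Notation "v *< a" := (ract v a) : ring_scope.

HB.mixin Record isBimodule (A B : pzRingType) V
    of GRing.Lmodule A V & Rmodule B V := {
  scaler_ractA : forall (a : A) (v : V) (b : B), a *: (v *< b) = (a *: v) *< b
}.

#[short(type="bimodType")]
HB.structure Definition Bimodule (A B : pzRingType) :=
  {V of GRing.Lmodule A V & Rmodule B V & isBimodule A B V}.

Section Regular.
Variable R : pzRingType.

HB.instance Definition _ := Zmodule_isRmodule.Build R R^o
  (fun v a b => esym (mulrA (v : R) a b)) (fun v => mulr1 (v : R))
  (fun a u v => mulrDl (u : R) v a) (fun v a b => mulrDr (v : R) a b).
HB.instance Definition _ := isBimodule.Build R R R^o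
  (fun a v b => mulrA a (v : R) b).

End Regular.

Definition bimod_hom (A B : pzRingType) (U V : bimodType A B) (f : U -> V) :=
  [/\ zmod_morphism f,
      forall (a : A) u, f (a *: u) = a *: f u
    & forall u (b : B), f (u *< b) = f u *< b].

Section RmoduleTheory.
Variables (R : pzRingType) (V : rmodType R).

Lemma ractr0 (v : V) : v *< (0 : R) = 0.
Proof. by apply: (addrI (v *< (0 : R))); rewrite -ractDr !addr0. Qed.

Lemma ract0r (a : R) : (0 : V) *< a = 0.
Proof. by apply: (addrI ((0 : V) *< a)); rewrite -ractDl !addr0. Qed.

Lemma ractNr (v : V) (a : R) : (- v) *< a = - (v *< a).
Proof. by apply/eqP; rewrite -addr_eq0 -ractDl addNr ract0r. Qed.

Lemma ractBl (u v : V) (a : R) : (u - v) *< a = u *< a - v *< a.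
Proof. by rewrite ractDl ractNr. Qed.

End RmoduleTheory.

Record rhom (R : pzRingType) (U V : rmodType R) := RHom {
  rhom_fun :> U -> V;
  rhomB : zmod_morphism rhom_fun;
  rhomZ : forall u (a : R), rhom_fun (u *< a) = rhom_fun u *< a
}.

HB.instance Definition _ (R : pzRingType) (U V : rmodType R) (f : rhom U V) :=
  GRing.isZmodMorphism.Build U V f (rhomB f).

Section RhomComp.
Variables (R : pzRingType) (U V W : rmodType R) (g : rhom V W) (f : rhom U V).

Fact rhom_comp_is_zmod_morphism : zmod_morphism (g \o f).
Proof. by move=> x y /=; rewrite !raddfB. Qed.
Fact rhom_comp_ract u (a : R) : (g \o f) (u *< a) = (g \o f) u *< a.
Proof. by rewrite /= !rhomZ. Qed.
Definition rhom_comp : rhom U W :=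
  RHom rhom_comp_is_zmod_morphism rhom_comp_ract.

End RhomComp.

Section Kernel.
Variables (R : pzRingType) (U V : rmodType R) (f : rhom U V).

Definition rker_pred : {pred U} := fun u => f u == 0.

Lemma rker_zmod_closed : zmod_closed rker_pred.
Proof.
split=> [|x y]; rewrite !unfold_in ?raddf0 // => /eqP fx /eqP fy.
by rewrite raddfB /= fx fy subrr.
Qed.
HB.instance Definition _ := GRing.isZmodClosed.Build U rker_pred
  rker_zmod_closed.

Record rker := RKer { rker_val : U; rker_valP : rker_val \in rker_pred }.
HB.instance Definition _ := [isSub for rker_val].
HB.instance Definition _ := [Choice of rker by <:].
HB.instance Definition _ := [SubChoice_isSubZmodule of rker by <:].

Lemma rker_ractP (x : rker) (a : R) : rker_val x *< a \in rker_pred.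
Proof.
by rewrite unfold_in rhomZ; move: (rker_valP x); rewrite unfold_in => /eqP ->;
   rewrite ract0r.
Qed.
Definition rker_ract x a := RKer (rker_ractP x a).

Fact rker_ractA v a b : rker_ract (rker_ract v a) b = rker_ract v (a * b).
Proof. by apply: val_inj => /=; rewrite ractA. Qed.
Fact rker_ractr1 v : rker_ract v 1 = v.
Proof. by apply: val_inj => /=; rewrite ractr1. Qed.
Fact rker_ractDl a : {morph rker_ract^~ a : u v / u + v}.
Proof. by move=> u v; apply: val_inj; rewrite /= ractDl. Qed.
Fact rker_ractDr v : {morph rker_ract v : a b / a + b}.
Proof. by move=> a b; apply: val_inj; rewrite /= ractDr. Qed.
HB.instance Definition _ := Zmodule_isRmodule.Build R rker
  rker_ractA rker_ractr1 rker_ractDl rker_ractDr.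

Fact rker_val_is_zmod_morphism : zmod_morphism rker_val.
Proof. exact: (raddfB val). Qed.

Definition rker_incl : rhom rker U :=
  RHom rker_val_is_zmod_morphism (fun _ _ => erefl).

End Kernel.

Section MalgLift.
Variables (K : choiceType) (G V : zmodType) (h : K -> {additive G -> V}).

Definition malg_lift (g : {malg G[K]}) : V := \sum_(k <- msupp g) h k g@_k.

Lemma malg_liftEw (d : {fset K}) g :
  (msupp g `<=` d)%fset -> malg_lift g = \sum_(k <- d) h k g@_k.
Proof.
move=> le_gd; rewrite /malg_lift.
rewrite -(big_fset_incl _ le_gd) // => k _ /mcoeff_outdom ->.
by rewrite raddf0.
Qed.

Fact malg_lift_is_zmod_morphism : zmod_morphism malg_lift.
Proof.
move=> g1 g2; pose d := (msupp g1 `|` msupp g2)%fset.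
rewrite (@malg_liftEw d (g1 - g2)) ?msuppB_le //.
rewrite (@malg_liftEw d g1) ?fsubsetUl // (@malg_liftEw d g2) ?fsubsetUr //.
by rewrite -sumrB; apply: eq_bigr => k _; rewrite mcoeffB raddfB.
Qed.
HB.instance Definition _ := GRing.isZmodMorphism.Build {malg G[K]} V malg_lift
  malg_lift_is_zmod_morphism.

Lemma malg_liftU x k : malg_lift << x *g k >> = h k x.
Proof.
by rewrite (malg_liftEw msuppU_le) big_seq_fset1 mcoeffUU.
Qed.

End MalgLift.

Section FreeModule.
Variables (R : pzRingType) (X : choiceType).

(* Finitely supported functions X -> R; R acts on the right of coefficients. *)
Definition free_rmod := {malg R[X]}.
HB.instance Definition _ := GRing.Zmodule.on free_rmod.

Definition free_ract (v : free_rmod) (a : R) : free_rmod :=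
  \sum_(x <- msupp v) << v@_x * a *g x >>.

Lemma coef_free_ract v a x : (free_ract v a)@_x = v@_x * a.
Proof.
rewrite /free_ract raddf_sum /=.
have [vx|/mcoeff_outdom v0] := boolP (x \in msupp v).
  rewrite (big_fsetD1 x) //= mcoeffUU big1_fset ?addr0 // => y.
  by rewrite in_fsetD1 => /andP[/negPf yx _] _; rewrite mcoeffU yx mulr0n.
rewrite v0 mul0r big1_seq // => y _; rewrite mcoeffU.
by case: eqP => [->|_]; rewrite ?v0 ?mul0r ?mulr0n ?mul0rn.
Qed.

Fact free_ractA v a b : free_ract (free_ract v a) b = free_ract v (a * b).
Proof. by apply/malgP => x; rewrite !coef_free_ract mulrA. Qed.
Fact free_ractr1 v : free_ract v 1 = v.
Proof. by apply/malgP => x; rewrite coef_free_ract mulr1. Qed.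
Fact free_ractDl a : {morph free_ract^~ a : u v / u + v}.
Proof.
by move=> u v; apply/malgP => x; rewrite mcoeffD !coef_free_ract mcoeffD mulrDl.
Qed.
Fact free_ractDr v : {morph free_ract v : a b / a + b}.
Proof.
by move=> a b; apply/malgP => x; rewrite mcoeffD !coef_free_ract mulrDr.
Qed.
HB.instance Definition _ := Zmodule_isRmodule.Build R free_rmod
  free_ractA free_ractr1 free_ractDl free_ractDr.

End FreeModule.

Section Augmentation.
Variables (R : pzRingType) (M : rmodType R).

Fact ract_is_zmod_morphism (m : M) : zmod_morphism (@ract R M m).
Proof.
move=> a b; apply/eqP; rewrite eq_sym subr_eq -ractDr.
by rewrite addrNK.
Qed.
HB.instance Definition _ m := GRing.isZmodMorphism.Build R M (@ract R M m)
  (ract_is_zmod_morphism m).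

Definition free_aug_fun : free_rmod R M -> M :=
  malg_lift (fun m => @ract R M m : {additive R -> M}).

Fact free_aug_is_zmod_morphism : zmod_morphism free_aug_fun.
Proof. exact: malg_lift_is_zmod_morphism. Qed.

Fact free_aug_ract (v : free_rmod R M) (a : R) :
  free_aug_fun (v *< a) = free_aug_fun v *< a.
Proof.
rewrite {1}/ract /= /free_ract /free_aug_fun raddf_sum /= /malg_lift.
have -> : (\sum_(k <- msupp v) k *< v@_k) *< a
          = \sum_(k <- msupp v) (k *< v@_k) *< a.
  apply: (big_morph (fun u : M => u *< a)); first exact: ractDl.
  exact: ract0r.
apply: eq_bigr => k _.
by rewrite [LHS](@malg_liftU _ _ _ (fun m => @ract R M m : {additive R -> M})) /= ractA.
Qed.

Definition free_aug : rhom (free_rmod R M) M :=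
  RHom free_aug_is_zmod_morphism free_aug_ract.

Lemma free_augU (m : M) : free_aug << 1 *g m >> = m.
Proof.
by rewrite /= /free_aug_fun malg_liftU /= ractr1.
Qed.

End Augmentation.

Section GeneratedSubgroup.
Variables (V : zmodType) (S : V -> Prop).

Definition gen_subgroup : {pred V} := fun x =>
  `[< forall P : {pred V}, zmod_closed P -> (forall s, S s -> s \in P) ->
      x \in P >].

Fact gen_subgroup_zmod_closed : zmod_closed gen_subgroup.
Proof.
split=> [|x y /asboolP Hx /asboolP Hy]; apply/asboolP => P cP SP.
  by case: cP.
by case: (cP) => _; apply; [apply: Hx | apply: Hy].
Qed.
HB.instance Definition _ := GRing.isZmodClosed.Build V gen_subgroup
  gen_subgroup_zmod_closed.

End GeneratedSubgroup.

Section Tensor.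
Variables (R : pzRingType) (M : rmodType R) (N : lmodType R).

Local Notation F := {malg int[(M * N)%type]}.
Local Notation "<[ m , n ]>" := (<< (1 : int) *g (m, n) >> : F).

Inductive tensor_rel : F -> Prop :=
| TensorDl m m' n : tensor_rel (<[m + m', n]> - <[m, n]> - <[m', n]>)
| TensorDr m n n' : tensor_rel (<[m, n + n']> - <[m, n]> - <[m, n']>)
| TensorA m (a : R) n : tensor_rel (<[m *< a, n]> - <[m, a *: n]>).

Definition tensor := Quotient.quot (gen_subgroup tensor_rel).
HB.instance Definition _ := GRing.Zmodule.on tensor.

Definition tens (m : M) (n : N) : tensor :=
  (\pi_(Quotient.quot (gen_subgroup tensor_rel)) <[m, n]>)%qT.

Let pi (x : F) : tensor := (\pi_(Quotient.quot (gen_subgroup tensor_rel)) x)%qT.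

Let pi_is_zmod_morphism : zmod_morphism pi.
Proof. by move=> x y; rewrite /pi raddfB. Qed.

Let pi0 x : x \in gen_subgroup tensor_rel -> pi x = 0.
Proof.
rewrite -[x]subr0 Quotient.idealrBE => /eqP; rewrite subr0 => xE.
by rewrite /pi xE [LHS]raddf0.
Qed.

Let rel0 x : tensor_rel x -> pi x = 0.
Proof. by move=> xr; apply: pi0; apply/asboolP => P _; apply. Qed.

Lemma tensDl n : {morph tens^~ n : m m' / m + m'}.
Proof.
move=> m m'; have := rel0 (TensorDl m m' n); rewrite !pi_is_zmod_morphism.
by move/eqP; rewrite -addrA -opprD subr_eq0 => /eqP.
Qed.

Lemma tensDr m : {morph tens m : n n' / n + n'}.
Proof.
move=> n n'; have := rel0 (TensorDr m n n'); rewrite !pi_is_zmod_morphism.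
by move/eqP; rewrite -addrA -opprD subr_eq0 => /eqP.
Qed.

Lemma tensA m (a : R) n : tens (m *< a) n = tens m (a *: n).
Proof.
have := rel0 (TensorA m a n); rewrite !pi_is_zmod_morphism.
by move/eqP; rewrite subr_eq0 => /eqP.
Qed.

Lemma tensor_indP (P : tensor -> Prop) :
  P 0 -> (forall t u, P t -> P u -> P (t - u)) -> (forall m n, P (tens m n)) ->
  forall t, P t.
Proof.
move=> P0 PB Pt t.
have PD u v : P u -> P v -> P (u + v).
  by move=> Pu Pv; rewrite -[v]opprK -[- v]sub0r; apply: (PB) => //; exact: (PB).
have pi_add x y : pi (x + y) = pi x + pi y by rewrite /pi [LHS]raddfD.
have -> : t = pi (repr t) by rewrite /pi reprK.
rewrite (monalgE (repr t)).
elim/big_rec: _ => [|[m n] x _ IH]; first by rewrite /pi [X in P X]raddf0.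
rewrite pi_add; apply: (PD) => //.
have PN u : P u -> P (- u) by move=> Pu; rewrite -sub0r; apply: PB.
have Pn k : P (pi << (k%:Z : int) *g (m, n) >>).
  elim: k => [|k IHk]; first by rewrite monalgU0 /pi [X in P X]raddf0.
  by rewrite -addn1 PoszD monalgUD pi_add; apply: (PD) => //; apply: Pt.
case: ((repr t)@_(m, n)) => k //.
rewrite NegzE monalgUN.
suff -> : pi (- << k.+1%:Z *g (m, n) >>) = - pi << k.+1%:Z *g (m, n) >>.
  exact: PN.
by rewrite /pi [LHS]raddfN.
Qed.

Record balanced (V : zmodType) (f : M -> N -> V) : Prop := Balanced {
  balancedDl : forall n, {morph f^~ n : m m' / m + m'};
  balancedDr : forall m, {morph f m : n n' / n + n'};
  balancedA : forall m (a : R) n, f (m *< a) n = f m (a *: n)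
}.

Section Lift.
Variables (V : zmodType) (f : M -> N -> V) (fP : balanced f).

Let g : F -> V :=
  malg_lift (fun k : M * N => intmul (f k.1 k.2) : {additive int -> V}).

Let gB : zmod_morphism g. Proof. exact: malg_lift_is_zmod_morphism. Qed.
Let gU m n : g <[m, n]> = f m n.
Proof. by rewrite /g malg_liftU. Qed.

Let g0 x : x \in gen_subgroup tensor_rel -> g x = 0.
Proof.
move=> /asboolP /(_ (fun x => g x == 0)) H; apply/eqP; apply: H.
  split=> [|y z]; rewrite !unfold_in; first by rewrite /g raddf0.
  by move=> /eqP gy /eqP gz; rewrite gB gy gz subrr.
move=> s; case=> [m m' n|m n n'|m a n]; rewrite unfold_in !gB !gU.
- by rewrite (balancedDl fP) -addrA -opprD subrr.
- by rewrite (balancedDr fP) -addrA -opprD subrr.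
- by rewrite (balancedA fP) subrr.
Qed.

Definition tensor_lift (_ : balanced f) (t : tensor) : V :=
  malg_lift (fun k : M * N => intmul (f k.1 k.2) : {additive int -> V})
    (repr t).

Let lift_pi x : tensor_lift fP (pi x) = g x.
Proof.
apply/eqP; rewrite -subr_eq0 -gB; apply/eqP; apply: g0.
by rewrite Quotient.idealrBE reprK.
Qed.

Fact tensor_lift_is_zmod_morphism : zmod_morphism (tensor_lift fP).
Proof.
move=> t u; have -> : t = pi (repr t) by rewrite /pi reprK.
have -> : u = pi (repr u) by rewrite /pi reprK.
by rewrite -pi_is_zmod_morphism !lift_pi gB.
Qed.

Lemma tensor_liftE m n : tensor_lift fP (tens m n) = f m n.
Proof. by rewrite lift_pi gU. Qed.

End Lift.

End Tensor.

Notation "m ⊗ n" := (tens m n) : ring_scope.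

HB.instance Definition _ (R : pzRingType) (M : rmodType R) (N : lmodType R)
    (V : zmodType) (f : M -> N -> V) (fP : balanced f) :=
  GRing.isZmodMorphism.Build (tensor M N) V (tensor_lift fP)
    (tensor_lift_is_zmod_morphism fP).

Lemma tensor_ext (R : pzRingType) (M : rmodType R) (N : lmodType R)
    (V : zmodType) (f g : tensor M N -> V) :
  zmod_morphism f -> zmod_morphism g ->
  (forall m n, f (m ⊗ n) = g (m ⊗ n)) -> f =1 g.
Proof.
move=> fB gB fg; apply: tensor_indP => // [|t u ft fu].
  by rewrite -(subrr 0) fB gB !subrr.
by rewrite fB gB ft fu.
Qed.

Section TensorMap.
Variables (R : pzRingType) (M M' : rmodType R) (N : lmodType R).
Variable (f : rhom M M').

Fact tensor_map_balanced : balanced (fun (m : M) (n : N) => f m ⊗ n).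
Proof.
split=> [n m m'|m n n'|m a n].
- by rewrite raddfD /= tensDl.
- by rewrite tensDr.
- by rewrite rhomZ tensA.
Qed.

Definition tensor_map : tensor M N -> tensor M' N :=
  tensor_lift tensor_map_balanced.
HB.instance Definition _ := GRing.Additive.on tensor_map.

End TensorMap.
Arguments tensor_map {R M M'} N f.

Section TensorBimodule.
Variables (B A C : pzRingType) (M : bimodType B A) (N : bimodType A C).

Local Notation T := (tensor M N).

Fact tensor_lact_balanced (b : B) :
  balanced (fun (m : M) (n : N) => (b *: m) ⊗ n).
Proof.
split=> [n m m'|m n n'|m a n].
- by rewrite scalerDr tensDl.
- by rewrite tensDr.
- by rewrite scaler_ractA tensA.
Qed.

Fact tensor_ract_balanced (c : C) :
  balanced (fun (m : M) (n : N) => m ⊗ (n *< c)).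
Proof.
split=> [n m m'|m n n'|m a n].
- by rewrite tensDl.
- by rewrite ractDl tensDr.
- by rewrite -scaler_ractA tensA.
Qed.

Definition tensor_lact (b : B) : T -> T :=
  tensor_lift (tensor_lact_balanced b).
Definition tensor_ract (t : T) (c : C) : T :=
  tensor_lift (tensor_ract_balanced c) t.

Let lactB b : zmod_morphism (tensor_lact b).
Proof. exact: tensor_lift_is_zmod_morphism. Qed.
Let ractB c : zmod_morphism (tensor_ract^~ c).
Proof. by move=> t u; rewrite /tensor_ract raddfB. Qed.
Let lactE b m n : tensor_lact b (m ⊗ n) = (b *: m) ⊗ n.
Proof. exact: tensor_liftE. Qed.
Let ractE c m n : tensor_ract (m ⊗ n) c = m ⊗ (n *< c).
Proof. exact: tensor_liftE. Qed.

Fact tensor_lactA a b t : tensor_lact a (tensor_lact b t) = tensor_lact (a * b) t.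
Proof.
apply: (tensor_ext (f := fun t => tensor_lact a (tensor_lact b t))) => //.
  by move=> x y /=; rewrite !lactB.
by move=> m n; rewrite !lactE scalerA.
Qed.
Fact tensor_lact1 : left_id 1 tensor_lact.
Proof.
by apply: tensor_ext => // m n; rewrite lactE scale1r.
Qed.
Fact tensor_lactDr : right_distributive tensor_lact +%R.
Proof. by move=> b; exact: (raddfD (tensor_lift (tensor_lact_balanced b))). Qed.
Fact tensor_lactDl t : {morph tensor_lact^~ t : a b / a + b}.
Proof.
move=> a b; apply: (tensor_ext (g := fun t => tensor_lact a t + tensor_lact b t)).
- exact: lactB.
- by move=> x y; rewrite !lactB opprD addrACA.
- by move=> m n; rewrite !lactE scalerDl tensDl.
Qed.
HB.instance Definition _ := GRing.Zmodule_isLmodule.Build B T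
  tensor_lactA tensor_lact1 tensor_lactDr tensor_lactDl.

Fact tensor_ractA t a b : tensor_ract (tensor_ract t a) b = tensor_ract t (a * b).
Proof.
apply: (tensor_ext (f := fun t => tensor_ract (tensor_ract t a) b)
                   (g := tensor_ract^~ (a * b))) => //.
  by move=> x y /=; rewrite !ractB.
by move=> m n; rewrite !ractE ractA.
Qed.
Fact tensor_ractr1 t : tensor_ract t 1 = t.
Proof.
apply: (tensor_ext (f := tensor_ract^~ 1) (g := id)) => // m n.
by rewrite ractE ractr1.
Qed.
Fact tensor_ractDl c : {morph tensor_ract^~ c : t u / t + u}.
Proof. exact: (raddfD (tensor_lift (tensor_ract_balanced c))). Qed.
Fact tensor_ractDr t : {morph tensor_ract t : a b / a + b}.
Proof.
move=> a b; apply: (tensor_ext (f := tensor_ract^~ (a + b))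
                     (g := fun t => tensor_ract t a + tensor_ract t b)).
- exact: ractB.
- by move=> x y; rewrite !ractB opprD addrACA.
- by move=> m n; rewrite !ractE ractDr tensDr.
Qed.
HB.instance Definition _ := Zmodule_isRmodule.Build C T
  tensor_ractA tensor_ractr1 tensor_ractDl tensor_ractDr.

Fact tensor_scaler_ractA (b : B) (t : T) (c : C) :
  b *: (t *< c) = (b *: t) *< c.
Proof.
apply: (tensor_ext (f := fun t => tensor_lact b (tensor_ract t c))
                   (g := fun t => tensor_ract (tensor_lact b t) c)).
- by move=> x y; rewrite ractB lactB.
- by move=> x y; rewrite lactB ractB.
- by move=> m n; rewrite ractE !lactE ractE.
Qed.
HB.instance Definition _ := isBimodule.Build B C T tensor_scaler_ractA.

Lemma scaler_tens (b : B) m n : b *: (m ⊗ n : T) = (b *: m) ⊗ n.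
Proof. exact: lactE. Qed.
Lemma ract_tens m n (c : C) : (m ⊗ n : T) *< c = m ⊗ (n *< c).
Proof. exact: ractE. Qed.

End TensorBimodule.

Section Homology.
Variables (U V W : zmodType) (d1 : {additive U -> V}) (d0 : {additive V -> W}).

Definition cycle_pred : {pred V} := fun v => d0 v == 0.

Fact cycle_zmod_closed : zmod_closed cycle_pred.
Proof.
split=> [|x y]; rewrite !unfold_in ?raddf0 // => /eqP fx /eqP fy.
by rewrite raddfB fx fy subrr.
Qed.
HB.instance Definition _ := GRing.isZmodClosed.Build V cycle_pred
  cycle_zmod_closed.

Record cycle := Cycle { cycle_val : V; _ : cycle_val \in cycle_pred }.
HB.instance Definition _ := [isSub for cycle_val].
HB.instance Definition _ := [Choice of cycle by <:].
HB.instance Definition _ := [SubChoice_isSubZmodule of cycle by <:].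

Definition boundary : {pred cycle} :=
  fun z => `[< exists u, d1 u = cycle_val z >].

Fact boundary_zmod_closed : zmod_closed boundary.
Proof.
split=> [|x y /asboolP[u ux] /asboolP[v vy]]; apply/asboolP.
  by exists 0; rewrite raddf0.
by exists (u - v); rewrite raddfB ux vy.
Qed.
HB.instance Definition _ := GRing.isZmodClosed.Build cycle boundary
  boundary_zmod_closed.

Definition homology : zmodType := Quotient.quot boundary.

End Homology.

Section Tor.
Variables (R : pzRingType) (M : rmodType R).

(* Tor is computed from the standard free resolution of M: the n-th term is the
   free module on the underlying set of the n-th syzygy, and syzygy n.+1 is the
   kernel of the augmentation from that term onto syzygy n. *)
Fixpoint syzygy (n : nat) : rmodType R :=
  if n is n'.+1 then rker (free_aug (syzygy n')) else M.

Definition resolution (n : nat) : rmodType R := free_rmod R (syzygy n).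

Definition resolution_diff (n : nat) : rhom (resolution n.+1) (resolution n) :=
  rhom_comp (rker_incl (free_aug (syzygy n))) (free_aug (syzygy n.+1)).

Lemma resolution_aug_surj (m : M) : exists x, free_aug (syzygy 0) x = m.
Proof. by exists << 1 *g m >>; rewrite free_augU. Qed.

Let diffE n (y : resolution n.+1) :
  resolution_diff n y = rker_val (free_aug (syzygy n.+1) y).
Proof. by []. Qed.

Lemma resolution_aug_exact n (x : resolution n) :
  free_aug (syzygy n) x = 0 <-> exists y, resolution_diff n y = x.
Proof.
split=> [x0|[y <-]].
  have xP : x \in rker_pred (free_aug (syzygy n)) by rewrite unfold_in x0.
  by exists << 1 *g (RKer xP : syzygy n.+1) >>; rewrite diffE free_augU.
by rewrite diffE; apply/eqP; exact: rker_valP.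
Qed.

Lemma resolution_exact n (x : resolution n.+1) :
  resolution_diff n x = 0 <-> exists y, resolution_diff n.+1 y = x.
Proof.
rewrite -resolution_aug_exact diffE; split=> [x0|->] //.
exact: (@val_inj _ _ (rker (free_aug (syzygy n)))).
Qed.

Variable N : lmodType R.

Definition tor_diff (n : nat) :
    {additive tensor (resolution n.+1) N -> tensor (resolution n) N} :=
  tensor_map N (resolution_diff n).

Definition Tor (n : nat) : zmodType :=
  if n is n'.+1 then homology (tor_diff n'.+1) (tor_diff n')
  else homology (tor_diff 0)
         (\0 : {additive tensor (resolution 0) N -> tensor (resolution 0) N}).

End Tor.

Definition trivial_zmod (V : zmodType) := forall x : V, x = 0.

Record idempotent_elt (R : pzRingType) := IdempotentElt {
  idem_val : R;
  idem_valP : idem_val * idem_val = idem_val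
}.

Section Corner.
Variables (R : pzRingType) (idem : idempotent_elt R).
Local Notation e := (idem_val idem).

Let ee : e * e = e. Proof. exact: idem_valP. Qed.

(* eRe, Re and eR, described as sets of fixed points *)
Definition corner_pred : {pred R} := fun x => e * x * e == x.
Definition Re_pred : {pred R} := fun x => x * e == x.
Definition eR_pred : {pred R} := fun x => e * x == x.

Lemma corner_predP x : reflect (exists r, x = e * r * e) (x \in corner_pred).
Proof.
apply: (iffP eqP) => [<-|[r ->]]; first by exists x.
by rewrite !mulrA ee -!mulrA ee.
Qed.
Lemma Re_predP x : reflect (exists r, x = r * e) (x \in Re_pred).
Proof. by apply: (iffP eqP) => [<-|[r ->]]; [exists x | rewrite -mulrA ee]. Qed.
Lemma eR_predP x : reflect (exists r, x = e * r) (x \in eR_pred).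
Proof. by apply: (iffP eqP) => [<-|[r ->]]; [exists x | rewrite mulrA ee]. Qed.

Fact corner_zmod_closed : zmod_closed corner_pred.
Proof.
split=> [|x y]; rewrite !unfold_in ?mulr0 ?mul0r // => /eqP ex /eqP ey.
by rewrite mulrBr mulrBl ex ey.
Qed.
Fact Re_zmod_closed : zmod_closed Re_pred.
Proof.
split=> [|x y]; rewrite !unfold_in ?mul0r // => /eqP ex /eqP ey.
by rewrite mulrBl ex ey.
Qed.
Fact eR_zmod_closed : zmod_closed eR_pred.
Proof.
split=> [|x y]; rewrite !unfold_in ?mulr0 // => /eqP ex /eqP ey.
by rewrite mulrBr ex ey.
Qed.
HB.instance Definition _ := GRing.isZmodClosed.Build R corner_pred
  corner_zmod_closed.
HB.instance Definition _ := GRing.isZmodClosed.Build R Re_pred Re_zmod_closed.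
HB.instance Definition _ := GRing.isZmodClosed.Build R eR_pred eR_zmod_closed.

Record corner := Corner
  { corner_val : R; corner_valP : corner_val \in corner_pred }.
HB.instance Definition _ := [isSub for corner_val].
HB.instance Definition _ := [Choice of corner by <:].
HB.instance Definition _ := [SubChoice_isSubZmodule of corner by <:].

Record Re := ReElt { Re_val : R; Re_valP : Re_val \in Re_pred }.
HB.instance Definition _ := [isSub for Re_val].
HB.instance Definition _ := [Choice of Re by <:].
HB.instance Definition _ := [SubChoice_isSubZmodule of Re by <:].

Record eR := ERElt { eR_val : R; eR_valP : eR_val \in eR_pred }.
HB.instance Definition _ := [isSub for eR_val].
HB.instance Definition _ := [Choice of eR by <:].
HB.instance Definition _ := [SubChoice_isSubZmodule of eR by <:].

Let corner_el (x : corner) : e * corner_val x = corner_val x.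
Proof. by case: x => x /= /corner_predP[r ->]; rewrite !mulrA ee. Qed.
Let corner_er (x : corner) : corner_val x * e = corner_val x.
Proof. by case: x => x /= /corner_predP[r ->]; rewrite -!mulrA ee. Qed.

Fact corner_oneP : e \in corner_pred.
Proof. by rewrite unfold_in !ee. Qed.
Fact corner_mulP (x y : corner) : corner_val x * corner_val y \in corner_pred.
Proof. by rewrite unfold_in mulrA corner_el -mulrA corner_er. Qed.

Definition corner_one := Corner corner_oneP.
Definition corner_mul x y := Corner (corner_mulP x y).

Fact corner_mulA : associative corner_mul.
Proof. by move=> x y z; apply: val_inj; rewrite /= mulrA. Qed.
Fact corner_mul1 : left_id corner_one corner_mul.
Proof. by move=> x; apply: val_inj; rewrite /= corner_el. Qed.
Fact corner_mulr1 : right_id corner_one corner_mul.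
Proof. by move=> x; apply: val_inj; rewrite /= corner_er. Qed.
Fact corner_mulDl : left_distributive corner_mul +%R.
Proof. by move=> x y z; apply: val_inj; rewrite /= mulrDl. Qed.
Fact corner_mulDr : right_distributive corner_mul +%R.
Proof. by move=> x y z; apply: val_inj; rewrite /= mulrDr. Qed.
HB.instance Definition _ := GRing.Zmodule_isPzRing.Build corner
  corner_mulA corner_mul1 corner_mulr1 corner_mulDl corner_mulDr.

Fact Re_ractP (x : Re) (a : corner) : Re_val x * corner_val a \in Re_pred.
Proof. by rewrite unfold_in -mulrA corner_er. Qed.
Definition Re_ract x a := ReElt (Re_ractP x a).

Fact Re_ractA v a b : Re_ract (Re_ract v a) b = Re_ract v (a * b).
Proof. by apply: val_inj; rewrite /= mulrA. Qed.
Fact Re_ractr1 v : Re_ract v 1 = v.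
Proof. by apply: val_inj => /=; case: v => v /= /eqP. Qed.
Fact Re_ractDl a : {morph Re_ract^~ a : u v / u + v}.
Proof. by move=> u v; apply: val_inj; rewrite /= mulrDl. Qed.
Fact Re_ractDr v : {morph Re_ract v : a b / a + b}.
Proof. by move=> a b; apply: val_inj; rewrite /= mulrDr. Qed.
HB.instance Definition _ := Zmodule_isRmodule.Build corner Re
  Re_ractA Re_ractr1 Re_ractDl Re_ractDr.

Fact eR_scaleP (a : corner) (x : eR) : corner_val a * eR_val x \in eR_pred.
Proof. by rewrite unfold_in mulrA corner_el. Qed.
Definition eR_scale a x := ERElt (eR_scaleP a x).

Fact eR_scaleA a b v : eR_scale a (eR_scale b v) = eR_scale (a * b) v.
Proof. by apply: val_inj; rewrite /= mulrA. Qed.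
Fact eR_scale1 : left_id 1 eR_scale.
Proof. by move=> v; apply: val_inj => /=; case: v => v /= /eqP. Qed.
Fact eR_scaleDr : right_distributive eR_scale +%R.
Proof. by move=> a u v; apply: val_inj; rewrite /= mulrDr. Qed.
Fact eR_scaleDl v : {morph eR_scale^~ v : a b / a + b}.
Proof. by move=> a b; apply: val_inj; rewrite /= mulrDl. Qed.
HB.instance Definition _ := GRing.Zmodule_isLmodule.Build corner eR
  eR_scaleA eR_scale1 eR_scaleDr eR_scaleDl.

Definition ReR_pred : {pred R} := fun x =>
  `[< exists s : seq (R * R), x = \sum_(p <- s) p.1 * e * p.2 >].

Fact ReR_zmod_closed : zmod_closed ReR_pred.
Proof.
split=> [|x y /asboolP[s ->] /asboolP[t ->]]; apply/asboolP.
  by exists [::]; rewrite big_nil.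
exists (s ++ [seq (- p.1, p.2) | p <- t]).
rewrite big_cat big_map -sumrN /=; congr (_ + _).
by apply: eq_bigr => p _; rewrite !mulNr.
Qed.
HB.instance Definition _ := GRing.isZmodClosed.Build R ReR_pred ReR_zmod_closed.

Record ReR := ReRElt { ReR_val : R; ReR_valP : ReR_val \in ReR_pred }.
HB.instance Definition _ := [isSub for ReR_val].
HB.instance Definition _ := [Choice of ReR by <:].
HB.instance Definition _ := [SubChoice_isSubZmodule of ReR by <:].

Fact ReR_mulP (x : Re) (y : eR) : Re_val x * eR_val y \in ReR_pred.
Proof.
apply/asboolP; exists [:: (Re_val x, eR_val y)].
by rewrite big_seq1 /=; case: x => x /= /eqP ->.
Qed.

Fact ReR_mul_balanced : balanced (fun x y => ReRElt (ReR_mulP x y)).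
Proof.
split=> [y x x'|x y y'|x a y]; apply: val_inj => /=.
- by rewrite mulrDl.
- by rewrite mulrDr.
- by rewrite mulrA.
Qed.

Definition ReR_mul : tensor Re eR -> ReR := tensor_lift ReR_mul_balanced.

Definition stratifying : Prop :=
  bijective ReR_mul /\ forall i, (0 < i)%N -> trivial_zmod (Tor Re eR i).

End Corner.

Record morita_context (A B : pzRingType) (N : bimodType A B) (M : bimodType B A)
    (phi : tensor M N -> B^o) (psi : tensor N M -> A^o) : Prop := {
  phi_hom : bimod_hom phi;
  psi_hom : bimod_hom psi;
  phi_psi : forall m n m', (phi (m ⊗ n) : B) *: m' = m *< (psi (n ⊗ m') : A);
  psi_phi : forall n m n', n *< (phi (m ⊗ n') : B) = (psi (n ⊗ m) : A) *: n'
}.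

Section MoritaRing.
Variables (A B : pzRingType) (N : bimodType A B) (M : bimodType B A).
Variables (phi : tensor M N -> B^o) (psi : tensor N M -> A^o).

(* The entries of the matrix are listed row by row. *)
Record morita_ring (C : morita_context phi psi) := MoritaMx {
  mor_a : A; mor_n : N;
  mor_m : M; mor_b : B
}.

Variable C : morita_context phi psi.
Local Notation L := (morita_ring C).
Local Notation Mx := (@MoritaMx C).

Definition morita_code (x : L) : A * N * M * B :=
  (mor_a x, mor_n x, mor_m x, mor_b x).
Definition morita_decode (t : A * N * M * B) : L :=
  let: (a, n, m, b) := t in Mx a n m b.
Fact morita_codeK : cancel morita_code morita_decode. Proof. by case. Qed.
HB.instance Definition _ := Choice.copy L (can_type morita_codeK).

Definition morita_zero : L := Mx 0 0 0 0.
Definition morita_opp (x : L) : L :=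
  Mx (- mor_a x) (- mor_n x) (- mor_m x) (- mor_b x).
Definition morita_add (x y : L) : L :=
  Mx (mor_a x + mor_a y) (mor_n x + mor_n y)
     (mor_m x + mor_m y) (mor_b x + mor_b y).

Fact morita_addA : associative morita_add.
Proof. by move=> x y z; congr MoritaMx; rewrite /= addrA. Qed.
Fact morita_addC : commutative morita_add.
Proof. by move=> x y; congr MoritaMx; rewrite /= addrC. Qed.
Fact morita_add0 : left_id morita_zero morita_add.
Proof. by case=> a n m b; congr MoritaMx; rewrite /= add0r. Qed.
Fact morita_addN : left_inverse morita_zero morita_opp morita_add.
Proof. by move=> x; congr MoritaMx; rewrite /= addNr. Qed.
HB.instance Definition _ := GRing.isZmodule.Build L
  morita_addA morita_addC morita_add0 morita_addN.

Definition morita_one : L := Mx 1 0 0 1.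
Definition morita_mul (x y : L) : L :=
  Mx (mor_a x * mor_a y + psi (mor_n x ⊗ mor_m y))
     (mor_a x *: mor_n y + mor_n x *< mor_b y)
     (mor_m x *< mor_a y + mor_b x *: mor_m y)
     (mor_b x * mor_b y + phi (mor_m x ⊗ mor_n y)).

Let phiD : {morph phi : t u / t + u}.
Proof.
case: (phi_hom C) => phiB _ _ t u.
have phi0 : phi 0 = 0 by rewrite -(subrr 0) phiB subrr.
by rewrite -{1}[u]opprK phiB -(sub0r u) phiB phi0 sub0r opprK.
Qed.
Let psiD : {morph psi : t u / t + u}.
Proof.
case: (psi_hom C) => psiB _ _ t u.
have psi0 : psi 0 = 0 by rewrite -(subrr 0) psiB subrr.
by rewrite -{1}[u]opprK psiB -(sub0r u) psiB psi0 sub0r opprK.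
Qed.
Let phiL (b : B) m n : phi ((b *: m) ⊗ n) = b * phi (m ⊗ n).
Proof. by case: (phi_hom C) => _ phiZ _; rewrite -scaler_tens phiZ. Qed.
Let phiR m n (b : B) : phi (m ⊗ (n *< b)) = (phi (m ⊗ n) : B) * b.
Proof. by case: (phi_hom C) => _ _ phiZ; rewrite -ract_tens phiZ. Qed.
Let psiL (a : A) n m : psi ((a *: n) ⊗ m) = a * psi (n ⊗ m).
Proof. by case: (psi_hom C) => _ psiZ _; rewrite -scaler_tens psiZ. Qed.
Let psiR n m (a : A) : psi (n ⊗ (m *< a)) = (psi (n ⊗ m) : A) * a.
Proof. by case: (psi_hom C) => _ _ psiZ; rewrite -ract_tens psiZ. Qed.

Fact morita_mulDl : left_distributive morita_mul morita_add.
Proof.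
move=> x y z; congr MoritaMx => /=.
- by rewrite mulrDl tensDl psiD addrACA.
- by rewrite scalerDl ractDl addrACA.
- by rewrite ractDl scalerDl addrACA.
- by rewrite mulrDl tensDl phiD addrACA.
Qed.
Fact morita_mulDr : right_distributive morita_mul morita_add.
Proof.
move=> x y z; congr MoritaMx => /=.
- by rewrite mulrDr tensDr psiD addrACA.
- by rewrite scalerDr ractDr addrACA.
- by rewrite ractDr scalerDr addrACA.
- by rewrite mulrDr tensDr phiD addrACA.
Qed.
Fact morita_mulA : associative morita_mul.
Proof.
move=> x y z; congr MoritaMx => /=.
- rewrite mulrDr mulrDl tensDr tensDl !psiD psiR psiL tensA.
  by rewrite mulrA -!addrA; congr (_ + _); rewrite addrCA.
- rewrite scalerDr scalerDl ractDl ractDr scalerA ractA scaler_ractA (psi_phi C).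
  by rewrite -!addrA; congr (_ + _); rewrite addrA addrC.
- rewrite ractDr ractDl scalerDr scalerDl ractA scalerA -scaler_ractA (phi_psi C).
  by rewrite -!addrA; congr (_ + _); rewrite addrC -addrA.
- rewrite mulrDr mulrDl tensDr tensDl !phiD phiR phiL tensA.
  by rewrite mulrA -!addrA; congr (_ + _); rewrite addrCA addrA addrC.
Qed.
Let tens0l (R : pzRingType) (U : rmodType R) (V : lmodType R) (v : V) :
  (0 : U) ⊗ v = 0.
Proof. by apply: (addrI ((0 : U) ⊗ v)); rewrite -tensDl !addr0. Qed.
Let tens0r (R : pzRingType) (U : rmodType R) (V : lmodType R) (u : U) :
  u ⊗ (0 : V) = 0.
Proof. by apply: (addrI (u ⊗ (0 : V))); rewrite -tensDr !addr0. Qed.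
Let phi0 : phi 0 = 0.
Proof. by apply: (addrI (phi 0)); rewrite -phiD !addr0. Qed.
Let psi0 : psi 0 = 0.
Proof. by apply: (addrI (psi 0)); rewrite -psiD !addr0. Qed.
Fact morita_mul1 : left_id morita_one morita_mul.
Proof.
case=> a n m b; congr MoritaMx => /=.
- by rewrite mul1r tens0l psi0 addr0.
- by rewrite scale1r ract0r addr0.
- by rewrite scale1r ract0r add0r.
- by rewrite mul1r tens0l phi0 addr0.
Qed.
Fact morita_mulr1 : right_id morita_one morita_mul.
Proof.
case=> a n m b; congr MoritaMx => /=.
- by rewrite mulr1 tens0r psi0 addr0.
- by rewrite scaler0 ractr1 add0r.
- by rewrite scaler0 ractr1 addr0.
- by rewrite mulr1 tens0r phi0 addr0.
Qed.
HB.instance Definition _ := GRing.Zmodule_isPzRing.Build L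
  morita_mulA morita_mul1 morita_mulr1 morita_mulDl morita_mulDr.

Fact morita_e_idem : Mx 1 0 0 0 * Mx 1 0 0 0 = Mx 1 0 0 0.
Proof.
congr MoritaMx => /=.
- by rewrite mulr1 tens0l psi0 addr0.
- by rewrite scaler0 ractr0 addr0.
- by rewrite ract0r scaler0 addr0.
- by rewrite mulr0 tens0l phi0 addr0.
Qed.
Definition morita_e := IdempotentElt morita_e_idem.

Fact morita_f_idem : Mx 0 0 0 1 * Mx 0 0 0 1 = Mx 0 0 0 1.
Proof.
congr MoritaMx => /=.
- by rewrite mulr0 tens0l psi0 addr0.
- by rewrite scaler0 ract0r addr0.
- by rewrite ractr0 scaler0 addr0.
- by rewrite mulr1 tens0l phi0 addr0.
Qed.
Definition morita_f := IdempotentElt morita_f_idem.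

End MoritaRing.

(* Main.v *)
(* The corner [eLe] is [A], and over it [Le = A + M] and [eL = A + N]. Hence
   [Le ⊗ eL = A + N + M + M ⊗ N], and multiplication is the identity on the
   first three summands and [phi] on the last, which settles the bijectivity.
   For the Tor groups, right exactness turns the vanishing of [Tor (n+1)] into
   the injectivity of [K ⊗ N -> F ⊗ N], where [K] is the kernel of the
   augmentation of the free module [F] on the [n]-th syzygy. Since [M] and [Le]
   are stable retracts of each other, so are their syzygies, and injectivity
   passes to stable retracts; the summand [A] of [eL] is harmless because
   [K ⊗ A -> F ⊗ A] is [K -> F]. Part (ii) is part (i) with the roles of the two
   idempotents exchanged. *)
Require Import Defs.
From HB Require Import structures.
From mathcomp Require Import all_boot all_algebra.
From mathcomp Require Import finmap boolp.
From mathcomp.multinomials Require Import monalg.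

Set Implicit Arguments.
Unset Strict Implicit.
Unset Printing Implicit Defensive.

Import GRing.Theory.
Local Open Scope ring_scope.

(** * Additive maps *)

Section ZmodMorphism.
Variables (U V : zmodType) (f : U -> V).
Hypothesis fB : zmod_morphism f.

Lemma zmod_morphism0 : f 0 = 0.
Proof. by rewrite -(subrr 0) fB subrr. Qed.

Lemma zmod_morphismD : {morph f : x y / x + y}.
Proof.
by move=> x y; rewrite -{1}[y]opprK fB -(sub0r y) fB zmod_morphism0 sub0r opprK.
Qed.

Lemma zmod_morphism_injective : (forall x, f x = 0 -> x = 0) -> injective f.
Proof.
move=> f0 x y fxy; apply/eqP; rewrite -subr_eq0; apply/eqP/f0.
by rewrite fB fxy subrr.
Qed.

End ZmodMorphism.

Lemma homo_zmod_morphism (U V : zmodType) (f : U -> V) :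
  {morph f : x y / x + y} -> zmod_morphism f.
Proof.
by move=> fD x y; apply/eqP; rewrite eq_sym subr_eq -fD addrNK.
Qed.

Lemma inj_surj_bijective (T U : Type) (f : T -> U) :
  injective f -> (forall y, exists x, f x = y) -> bijective f.
Proof.
move=> finj fsurj; have [g gK] := choice fsurj.
by exists g => // x; apply: finj; rewrite gK.
Qed.

(** * Elementary identities in tensor products *)

Section TensorZero.
Variables (R : pzRingType) (M : rmodType R) (N : lmodType R).

Lemma tensBl (m m' : M) (n : N) : (m - m') ⊗ n = m ⊗ n - m' ⊗ n.
Proof. exact: (homo_zmod_morphism (@tensDl R M N n)). Qed.

Lemma tensBr (m : M) (n n' : N) : m ⊗ (n - n') = m ⊗ n - m ⊗ n'.
Proof. exact: (homo_zmod_morphism (@tensDr R M N m)). Qed.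

Lemma tens0l (n : N) : (0 : M) ⊗ n = 0.
Proof. exact: (zmod_morphism0 (homo_zmod_morphism (@tensDl R M N n))). Qed.

Lemma tens0r (m : M) : m ⊗ (0 : N) = 0.
Proof. exact: (zmod_morphism0 (homo_zmod_morphism (@tensDr R M N m))). Qed.

(** Expand [m] as [m' *< a] plus a remainder, and [n] as [b *: n'] plus a remainder. It is meant for
    [m'] and [n'] both equal to the idempotent, with [a] and [b] the corner parts of [m] and [n]:
    the last term is then the part coming from [M ⊗ N]. *)
Lemma tens_decomp (m m' : M) (a b : R) (n n' : N) :
  m ⊗ n = m' ⊗ (a *: n) + (m - m' *< a) *< b ⊗ n'
          + (m - m' *< a) ⊗ (n - b *: n').
Proof.
by rewrite -tensA [_ *< b ⊗ _]tensA -addrA -tensDr subrKC -tensDl subrKC.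
Qed.

End TensorZero.

(** * Semilinear maps and free modules *)

(** The corner ring is only isomorphic to [A], so maps between modules over the two rings are linear
    along a ring morphism; no module has to be transported. *)
Definition semilinear_ract (R S : pzRingType) (s : R -> S) (U : rmodType R)
    (V : rmodType S) (f : U -> V) :=
  zmod_morphism f /\ forall u a, f (u *< a) = f u *< s a.

Definition semilinear_lact (R S : pzRingType) (s : R -> S) (U : lmodType R)
    (V : lmodType S) (f : U -> V) :=
  zmod_morphism f /\ forall a u, f (a *: u) = s a *: f u.

Lemma rhom_semilinear (R : pzRingType) (U V : rmodType R) (f : rhom U V) :
  semilinear_ract idfun f.
Proof. by split; [exact: rhomB | exact: rhomZ]. Qed.

Lemma semilinear_balanced (R S : pzRingType) (s : R -> S) (M : rmodType R)
    (N : lmodType R) (M' : rmodType S) (N' : lmodType S)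
    (f : M -> M') (g : N -> N') :
  semilinear_ract s f -> semilinear_lact s g ->
  balanced (fun m n => f m ⊗ g n).
Proof.
move=> [fB fZ] [gB gZ]; split=> [n m m'|m n n'|m a n].
- by rewrite (zmod_morphismD fB) tensDl.
- by rewrite (zmod_morphismD gB) tensDr.
- by rewrite fZ gZ tensA.
Qed.

Section FreeLift.
Variables (R S : pzRingType) (s : {rmorphism R -> S}) (X : choiceType).

Lemma free_ractU (x : X) (a b : R) :
  (<< a *g x >> : free_rmod R X) *< b = << a * b *g x >>.
Proof.
apply/malgP => y; rewrite [LHS]coef_free_ract !mcoeffU.
by case: eqP => _; rewrite ?mulr1n ?mulr0n ?mul0r.
Qed.

Lemma free_rmodE (v : free_rmod R X) :
  v = \sum_(x <- msupp v) (<< 1 *g x >> : free_rmod R X) *< v@_x.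
Proof.
rewrite {1}(monalgE v); apply: eq_bigr => x _.
by rewrite free_ractU mul1r.
Qed.

Variable V : rmodType S.

Lemma semilinear_free_ext (f g : free_rmod R X -> V) :
  semilinear_ract s f -> semilinear_ract s g ->
  (forall x, f << 1 *g x >> = g << 1 *g x >>) -> f =1 g.
Proof.
move=> [fB fZ] [gB gZ] fg v; rewrite (free_rmodE v).
rewrite (big_morph f (zmod_morphismD fB) (zmod_morphism0 fB)).
rewrite (big_morph g (zmod_morphismD gB) (zmod_morphism0 gB)).
by apply: eq_bigr => x _; rewrite fZ gZ fg.
Qed.

Variable h : X -> V.

(** Packaged as an additive map in the coefficient, the form in which [malg_lift] takes its data. *)
Definition ract_along (v : V) (a : R) : V := v *< s a.

Fact ract_along_is_zmod_morphism v : zmod_morphism (ract_along v).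
Proof. by move=> a b; rewrite /ract_along rmorphB raddfB. Qed.
HB.instance Definition _ v := GRing.isZmodMorphism.Build R V (ract_along v)
  (ract_along_is_zmod_morphism v).

Definition free_lift : free_rmod R X -> V :=
  malg_lift (fun x => ract_along (h x) : {additive R -> V}).

Fact free_lift_zmod_morphism : zmod_morphism free_lift.
Proof. exact: malg_lift_is_zmod_morphism. Qed.

Lemma free_liftU x a : free_lift << a *g x >> = h x *< s a.
Proof. exact: malg_liftU. Qed.

Lemma free_lift1 x : free_lift << 1 *g x >> = h x.
Proof. by rewrite free_liftU rmorph1 ractr1. Qed.

Lemma free_lift_semilinear : semilinear_ract s free_lift.
Proof.
split=> [|v a]; first exact: free_lift_zmod_morphism.
have liftD := zmod_morphismD free_lift_zmod_morphism.
have lift0 := zmod_morphism0 free_lift_zmod_morphism.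
have sumZ (T : pzRingType) (W : rmodType T) (b : T) r (F : X -> W) :
    (\sum_(x <- r) F x) *< b = \sum_(x <- r) F x *< b.
  by apply: (big_morph (fun w : W => w *< b)); [exact: ractDl | exact: ract0r].
rewrite [in LHS](free_rmodE v) [in RHS](free_rmodE v) sumZ.
rewrite !(big_morph _ liftD lift0) sumZ; apply: eq_bigr => x _.
by rewrite !free_ractU !free_liftU ractA -rmorphM.
Qed.

End FreeLift.

(** * Right exactness of the tensor product on the standard presentation *)

Section RightExactness.
Variables (R : pzRingType) (M : rmodType R) (N : lmodType R).

Local Notation aug := (free_aug M).
Local Notation incl := (rker_incl aug).

Lemma tensor_mapE (U V : rmodType R) (f : rhom U V) u (n : N) :
  tensor_map N f (u ⊗ n) = f u ⊗ n.
Proof. exact: tensor_liftE. Qed.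

Lemma tensor_map_comp (U V W : rmodType R) (g : rhom V W) (f : rhom U V) t :
  tensor_map N (rhom_comp g f) t = tensor_map N g (tensor_map N f t).
Proof.
apply: (tensor_ext (f := tensor_map N (rhom_comp g f))
  (g := fun t => tensor_map N g (tensor_map N f t))) => [x y|x y|m n].
- by rewrite raddfB.
- by rewrite !raddfB.
- by rewrite !tensor_mapE.
Qed.

Lemma tensor_map_surj (U V : rmodType R) (f : rhom U V) :
  (forall v, exists u, f u = v) -> forall t, exists z, tensor_map N f z = t.
Proof.
move=> fs; apply: tensor_indP => [|t t' [z <-] [z' <-]|v n].
- by exists 0; rewrite raddf0.
- by exists (z - z'); rewrite raddfB.
- by have [u <-] := fs v; exists (u ⊗ n); rewrite tensor_mapE.
Qed.

Lemma tensor_free_aug_surj t : exists z, tensor_map N aug z = t.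
Proof.
by apply: tensor_map_surj => m; exists << 1 *g m >>; exact: free_augU.
Qed.

Lemma tensor_free_aug_incl t : tensor_map N aug (tensor_map N incl t) = 0.
Proof.
apply: (tensor_ext (f := fun t => tensor_map N aug (tensor_map N incl t))
  (g := fun=> 0)) => [x y|x y|k n].
- by rewrite !raddfB.
- by rewrite subrr.
- rewrite !tensor_mapE; have /eqP k0 := rker_valP k.
  by rewrite [aug _]k0 tens0l.
Qed.

Let im : {pred tensor (free_rmod R M) N} :=
  fun z => `[< exists y, tensor_map N incl y = z >].

Let im_closed : zmod_closed im.
Proof.
split=> [|x y /asboolP[u <-] /asboolP[v <-]]; apply/asboolP.
  by exists 0; rewrite raddf0.
by exists (u - v); rewrite raddfB.
Qed.
HB.instance Definition _ := GRing.isZmodClosed.Build _ im im_closed.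

(* A section of the augmentation is additive and balanced modulo the image of
   the kernel, so it inverts [tensor_map N aug] modulo that image. *)
Lemma tensor_free_aug_exact z :
  tensor_map N aug z = 0 -> exists y, tensor_map N incl y = z.
Proof.
pose Q : zmodType := Quotient.quot im.
pose q (x : tensor (free_rmod R M) N) : Q := (\pi_(Quotient.quot im) x)%qT.
have qB : zmod_morphism q by move=> x y; rewrite /q raddfB.
have qE x y : q x = q y <-> exists u, tensor_map N incl u = x - y.
  split=> [/eqP|H].
    by rewrite -Quotient.idealrBE => /asboolP.
  by apply/eqP; rewrite -Quotient.idealrBE; apply/asboolP.
(* Two elements with the same augmentation differ by an element of the kernel. Hence [m] may be
   replaced by its basis element in the free module, a choice that is additive and linear only
   modulo [im]. *)
have q_eq (u v : free_rmod R M) n : aug u = aug v -> q (u ⊗ n) = q (v ⊗ n).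
  move=> uv; apply/qE.
  have uvP : u - v \in rker_pred aug by rewrite unfold_in (rhomB aug) uv subrr.
  exists ((RKer uvP : rker aug) ⊗ n).
  by rewrite tensor_mapE /= tensBl.
pose b (m : M) (n : N) : Q := q ((<< 1 *g m >> : free_rmod R M) ⊗ n).
have bal : balanced b.
  split=> [n m m'|m n n'|m a n]; rewrite /b.
  - rewrite -(zmod_morphismD qB) -tensDl; apply: q_eq.
    by rewrite (zmod_morphismD (rhomB aug)) !free_augU.
  - by rewrite tensDr (zmod_morphismD qB).
  - by rewrite -tensA; apply: q_eq; rewrite rhomZ !free_augU.
have qlift x : tensor_lift bal (tensor_map N aug x) = q x.
  apply: (tensor_ext (f := fun x => tensor_lift bal (tensor_map N aug x))).
  - by move=> x1 x2; rewrite !raddfB.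
  - exact: qB.
  - move=> v n; rewrite tensor_mapE tensor_liftE; apply: q_eq.
    by rewrite free_augU.
move=> z0; have /qE[y yE] : q z = q 0.
  by rewrite -qlift z0 raddf0 (zmod_morphism0 qB).
by exists y; rewrite yE subr0.
Qed.

End RightExactness.

(** * Vanishing of Tor as injectivity on syzygies *)

Section TorInjective.
Variables (R : pzRingType) (M : rmodType R) (N : lmodType R).

Lemma homology_trivialP (U V W : zmodType) (d1 : {additive U -> V})
    (d0 : {additive V -> W}) :
  trivial_zmod (homology d1 d0) <->
  (forall v, d0 v = 0 -> exists u, d1 u = v).
Proof.
split=> [H v v0|H x].
  have vP : v \in cycle_pred d0 by rewrite unfold_in v0.
  have /eqP := H (\pi_(Quotient.quot (boundary d1 (d0:=d0))) (Cycle vP))%qT.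
  rewrite -(raddf0 (\pi_(Quotient.quot (boundary d1 (d0:=d0))))%qT).
  by rewrite -Quotient.idealrBE subr0 => /asboolP.
rewrite -[x]reprK -[RHS](raddf0 (\pi_(Quotient.quot (boundary d1 (d0:=d0))))%qT).
apply/eqP; rewrite -Quotient.idealrBE subr0; apply/asboolP; apply: H.
by apply/eqP; case: (repr x).
Qed.

Lemma tor_diffE n (z : tensor (resolution M n.+1) N) :
  tor_diff M N n z = tensor_map N (rker_incl (free_aug (syzygy M n)))
    (tensor_map N (free_aug (syzygy M n.+1)) z).
Proof. exact: tensor_map_comp. Qed.

(** The differential is the augmentation onto the next syzygy followed by its inclusion, both
    tensored with [N]. The first factor is onto, and its kernel is the image of the following
    differential. Cycles are therefore boundaries exactly when the second factor kills nothing. *)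
Lemma TorS_trivialP n :
  trivial_zmod (Tor M N n.+1) <->
  injective (tensor_map N (rker_incl (free_aug (syzygy M n)))).
Proof.
rewrite /Tor homology_trivialP; split=> H.
  apply: zmod_morphism_injective => [|y]; first exact: raddfB.
  have [z <-] := tensor_free_aug_surj y.
  rewrite -tor_diffE => /H[u <-]; rewrite tor_diffE.
  exact: tensor_free_aug_incl.
move=> z; rewrite tor_diffE => z0.
have /tensor_free_aug_exact[y <-] :
    tensor_map N (free_aug (syzygy M n.+1)) z = 0 by apply: H; rewrite z0 raddf0.
have [u <-] := tensor_free_aug_surj y.
by exists u; rewrite tor_diffE.
Qed.

End TorInjective.

(* [M'] is a retract of [M] in the stable category of modules (modulo maps
   factoring through free modules), along ring morphisms [s] and [t]. *)
Definition stable_retract (R S : pzRingType) (s : R -> S) (t : S -> R)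
    (M : rmodType R) (M' : rmodType S) :=
  exists (j : M' -> M) (p : M -> M') (X : choiceType)
    (u : M' -> free_rmod S X) (v : free_rmod S X -> M'),
  [/\ semilinear_ract t j, semilinear_ract s p, semilinear_ract idfun u,
      semilinear_ract idfun v & forall m, p (j m) = m + v (u m)].

(** * Transfer of Tor vanishing along stable retracts *)

Section StableRetract.
Variables (R S : pzRingType) (s : {rmorphism R -> S}) (t : {rmorphism S -> R}).
Hypothesis tK : cancel t s.

Section Syzygy.
Variables (M : rmodType R) (M' : rmodType S).

Local Notation K := (rker (free_aug M)).
Local Notation K' := (rker (free_aug M')).
Local Notation F := (free_rmod R M).
Local Notation F' := (free_rmod S M').

(** Lift [j], [p] and [v] to the free covers on basis elements and restrict the first two lifts to
    the kernels. The error [h] is defined on the whole of [F'], so on [K'] it factors through a free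
    module, as a stable retract requires. *)
Lemma stable_retract_lift : stable_retract s t M M' ->
  exists (f : F' -> F) (j : K' -> K) (p : K -> K') (h : F' -> K'),
  [/\ semilinear_ract t f, semilinear_ract t j, semilinear_ract s p
    & semilinear_ract idfun h] /\
  [/\ forall k, rker_val (j k) = f (rker_val k)
    & forall k, p (j k) = k + h (rker_val k)].
Proof.
move=> [j [p [X [u [v [jP pP [uB uZ] vP pjE]]]]]].
pose f : F' -> F := free_lift t (fun m => << 1 *g j m >> : F).
pose g : F -> F' := free_lift s (fun m => << 1 *g p m >> : F').
pose w : free_rmod S X -> F' :=
  free_lift idfun (fun x => << 1 *g v << 1 *g x >> >> : F').
have [fB fZ] : semilinear_ract t f by exact: free_lift_semilinear.
have [gB gZ] : semilinear_ract s g by exact: free_lift_semilinear.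
have [wB wZ] : semilinear_ract idfun w by exact: free_lift_semilinear.
have [eB eZ] := rhom_semilinear (free_aug M).
have [eB' eZ'] := rhom_semilinear (free_aug M').
have [[jB jZ] [pB pZ] [vB vZ]] := And3 jP pP vP.
have ef y : free_aug M (f y) = j (free_aug M' y).
  apply: (semilinear_free_ext (s := t) (f := fun y => free_aug M (f y))
    (g := fun y => j (free_aug M' y))).
  - by split=> [y1 y2|y1 a]; rewrite ?fB ?fZ ?eB ?eZ.
  - by split=> [y1 y2|y1 a]; rewrite ?eB' ?eZ' ?jB ?jZ.
  - by move=> m; rewrite /f free_lift1 !free_augU.
have eg y : free_aug M' (g y) = p (free_aug M y).
  apply: (semilinear_free_ext (s := s) (f := fun y => free_aug M' (g y))
    (g := fun y => p (free_aug M y))).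
  - by split=> [y1 y2|y1 a]; rewrite ?gB ?gZ ?eB' ?eZ'.
  - by split=> [y1 y2|y1 a]; rewrite ?eB ?eZ ?pB ?pZ.
  - by move=> m; rewrite /g free_lift1 !free_augU.
have ew y : free_aug M' (w y) = v y.
  apply: (semilinear_free_ext (s := idfun) (f := fun y => free_aug M' (w y))).
  - by split=> [y1 y2|y1 a]; rewrite ?wB ?wZ ?eB' ?eZ'.
  - exact: vP.
  - by move=> x; rewrite /w free_lift1 free_augU.
have kerE (k : K) : free_aug M (rker_val k) = 0 by apply/eqP; exact: rker_valP.
have kerE' (k : K') : free_aug M' (rker_val k) = 0.
  by apply/eqP; exact: rker_valP.
have fP (k : K') : f (rker_val k) \in rker_pred (free_aug M).
  by rewrite unfold_in ef kerE' (zmod_morphism0 jB).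
have gP (k : K) : g (rker_val k) \in rker_pred (free_aug M').
  by rewrite unfold_in eg kerE (zmod_morphism0 pB).
(* Augmenting [g (f y)] gives [p (j m)] for [m] the augmentation of [y], that is [m + v (u m)];
   subtracting [y] and a lift of [v (u m)] lands in the kernel. For [y] in [K'] the last term
   vanishes and [g (f y) - y] remains. *)
have hP (y : F') :
    g (f y) - y - w (u (free_aug M' y)) \in rker_pred (free_aug M').
  rewrite unfold_in !eB' ew eg ef pjE.
  by rewrite -addrA -opprD subrr.
exists f, (fun k => RKer (fP k)), (fun k => RKer (gP k)), (fun y => RKer (hP y)).
split; split.
- by split.
- split=> [k1 k2|k a]; apply: (@val_inj _ _ (rker (free_aug M))); rewrite /=.
    by rewrite fB.
  by rewrite fZ.
- split=> [k1 k2|k a]; apply: (@val_inj _ _ (rker (free_aug M'))); rewrite /=.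
    by rewrite gB.
  by rewrite gZ.
- split=> [y1 y2|y a]; apply: (@val_inj _ _ (rker (free_aug M'))); rewrite /=.
    rewrite fB gB [free_aug_fun _]eB' uB wB.
    set x1 := g _; set x2 := g _; set z1 := w _; set z2 := w _.
    by rewrite !opprD !opprK [in RHS]addrACA; congr (_ + _); rewrite addrACA.
  (* The composite of [g] and [f] is linear along [s] after [t], which [tK] turns into the
     identity. *)
  by rewrite fZ gZ [free_aug_fun _]eZ' uZ wZ tK !ractBl.
- by [].
- move=> k; apply: (@val_inj _ _ (rker (free_aug M'))) => /=.
  rewrite [free_aug_fun _](kerE' k) (zmod_morphism0 uB) (zmod_morphism0 wB).
  by rewrite subr0 addrC subrK.
Qed.

Lemma stable_retract_rker : stable_retract s t M M' -> stable_retract s t K K'.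
Proof.
move=> /stable_retract_lift[f [j [p [h [[_ jP pP hP] [_ pjE]]]]]].
exists j, p, (M' : choiceType), (@rker_val _ _ _ (free_aug M')), h; split => //.
Qed.

Variables (N : lmodType R) (N' : lmodType S).
Variables (j : N' -> N) (p : N -> N') (chi : N' -> S) (w : N').
Hypotheses (jP : semilinear_lact t j) (pP : semilinear_lact s p).
Hypotheses (chiB : zmod_morphism chi).
Hypotheses (chiZ : forall a n, chi (a *: n) = a * chi n).
Hypothesis pjE : forall n, p (j n) = n + chi n *: w.

(** Here [N'] is a retract of [N] up to the error [chi n *: w], which factors through [S]. If [x]
    dies in [F' ⊗ N'], then [J x] dies in [F ⊗ N], so [J x = 0] by [inj]. Going back, [P (J x)] is
    [x] plus two errors: the one from [h] factors through the image of [x] in [F' ⊗ N'], and the one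
    from [chi] vanishes separately. *)
Lemma stable_retract_tensor_injective : stable_retract s t M M' ->
  injective (tensor_map N (rker_incl (free_aug M))) ->
  injective (tensor_map N' (rker_incl (free_aug M'))).
Proof.
move=> /stable_retract_lift[f [jK [pK [h [[fP jKP pKP hP] [fE pjKE]]]]]] inj.
apply: zmod_morphism_injective => [|x x0]; first exact: raddfB.
pose J := tensor_lift (semilinear_balanced jKP jP).
pose P := tensor_lift (semilinear_balanced pKP pP).
pose Jf := tensor_lift (semilinear_balanced fP jP).
have pjP : semilinear_lact idfun (fun n => p (j n)).
  case: jP pP => [jB jZ] [pB pZ].
  by split=> [n n'|a n]; rewrite ?jB ?pB // jZ pZ tK.
pose H := tensor_lift (semilinear_balanced hP pjP).
have chibal (U : rmodType S) : balanced (fun (k : U) n => k *< chi n).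
  split=> [n k k'|k n n'|k a n].
  - by rewrite ractDl.
  - by rewrite (zmod_morphismD chiB) ractDr.
  - by rewrite chiZ ractA.
have Jx : tensor_map N (rker_incl (free_aug M)) (J x) = 0.
  rewrite -[RHS](raddf0 Jf) -x0.
  apply: (tensor_ext (f := fun x => tensor_map N _ (J x))
           (g := fun x => Jf (tensor_map N' _ x))).
  - by move=> y1 y2; rewrite /J /Jf !raddfB.
  - by move=> y1 y2; rewrite /J /Jf !raddfB.
  - by move=> k n; rewrite /J /Jf tensor_mapE !tensor_liftE tensor_mapE /= fE.
have J0 : J x = 0 by apply: inj; rewrite Jx raddf0.
(* Contracting with [chi] amounts to passing to [K' ⊗ S = K'], where the map to [F' ⊗ S = F'] is the
   inclusion and so is injective. *)
have chi0 : tensor_lift (chibal (rker (free_aug M'))) x = 0.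
  apply: (@val_inj _ _ (rker (free_aug M'))) => /=.
  rewrite -[RHS](raddf0 (tensor_lift (chibal (free_rmod S M')))) -x0.
  apply: (tensor_ext (f := fun x => rker_val (tensor_lift (chibal _) x))
           (g := fun x => tensor_lift (chibal _) (tensor_map N' _ x))).
  - by move=> y1 y2; rewrite !raddfB.
  - by move=> y1 y2; rewrite !raddfB.
  - by move=> k n; rewrite tensor_mapE !tensor_liftE.
have PJ : P (J x) = x + tensor_lift (chibal (rker (free_aug M'))) x ⊗ w
    + H (tensor_map N' (rker_incl (free_aug M')) x).
  apply: (tensor_ext (f := fun x => P (J x))
    (g := fun x => x + tensor_lift (chibal (rker (free_aug M'))) x ⊗ w
    + H (tensor_map N' (rker_incl (free_aug M')) x))).
  - by move=> y1 y2; rewrite /P /J !raddfB.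
  - move=> y1 y2; rewrite /H !raddfB tensBl.
    by rewrite !opprD [in RHS]addrACA; congr (_ + _); rewrite addrACA.
  - move=> k n; rewrite /P /J /H tensor_mapE !tensor_liftE pjKE tensDl.
    by rewrite {1}pjE tensDr tensA.
by move: PJ; rewrite J0 chi0 x0 /P /H !raddf0 tens0l !addr0.
Qed.

End Syzygy.

Lemma stable_retract_syzygy (M : rmodType R) (M' : rmodType S) n :
  stable_retract s t M M' -> stable_retract s t (syzygy M n) (syzygy M' n).
Proof. by move=> H; elim: n => //= n IH; exact: stable_retract_rker. Qed.

Lemma stable_retract_Tor_trivial (M : rmodType R) (M' : rmodType S)
    (N : lmodType R) (N' : lmodType S)
    (j : N' -> N) (p : N -> N') (chi : N' -> S) (w : N') :
  stable_retract s t M M' -> semilinear_lact t j -> semilinear_lact s p ->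
  zmod_morphism chi -> (forall a n, chi (a *: n) = a * chi n) ->
  (forall n, p (j n) = n + chi n *: w) ->
  (forall i, (0 < i)%N -> trivial_zmod (Tor M N i)) ->
  forall i, (0 < i)%N -> trivial_zmod (Tor M' N' i).
Proof.
move=> MM' jP pP chiB chiZ pjE TorM [//|i] _.
apply/TorS_trivialP.
apply: (stable_retract_tensor_injective jP pP chiB chiZ pjE).
  exact: stable_retract_syzygy MM'.
by apply/TorS_trivialP; exact: TorM.
Qed.

End StableRetract.

(** * Projections onto [Le], [eL] and [eLe] *)

Section CornerProjections.
Variables (L : pzRingType) (idem : idempotent_elt L).
Local Notation e := (idem_val idem).

Fact Re_projP l : l * e \in Re_pred idem.
Proof. by apply/Re_predP; exists l. Qed.
Definition Re_proj l : Re idem := ReElt (Re_projP l).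

Fact eR_projP l : e * l \in eR_pred idem.
Proof. by apply/eR_predP; exists l. Qed.
Definition eR_proj l : eR idem := ERElt (eR_projP l).

Fact corner_projP l : e * l * e \in corner_pred idem.
Proof. by apply/corner_predP; exists l. Qed.
Definition corner_proj l : corner idem := Corner (corner_projP l).

Fact Re_proj_is_zmod_morphism : zmod_morphism Re_proj.
Proof. by move=> x y; apply: val_inj; rewrite /= mulrBl. Qed.
Fact eR_proj_is_zmod_morphism : zmod_morphism eR_proj.
Proof. by move=> x y; apply: val_inj; rewrite /= mulrBr. Qed.
Fact corner_proj_is_zmod_morphism : zmod_morphism corner_proj.
Proof. by move=> x y; apply: val_inj; rewrite /= mulrBr mulrBl. Qed.
HB.instance Definition _ := GRing.isZmodMorphism.Build L (Re idem) Re_proj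
  Re_proj_is_zmod_morphism.
HB.instance Definition _ := GRing.isZmodMorphism.Build L (eR idem) eR_proj
  eR_proj_is_zmod_morphism.
HB.instance Definition _ := GRing.isZmodMorphism.Build L (corner idem)
  corner_proj corner_proj_is_zmod_morphism.

Fact Re_val_is_zmod_morphism : zmod_morphism (@Re_val L idem).
Proof. exact: (raddfB val). Qed.
Fact eR_val_is_zmod_morphism : zmod_morphism (@eR_val L idem).
Proof. exact: (raddfB val). Qed.
Fact corner_val_is_zmod_morphism : zmod_morphism (@corner_val L idem).
Proof. exact: (raddfB val). Qed.
Fact ReR_val_is_zmod_morphism : zmod_morphism (@ReR_val L idem).
Proof. exact: (raddfB val). Qed.
HB.instance Definition _ := GRing.isZmodMorphism.Build (Re idem) L
  (@Re_val L idem) Re_val_is_zmod_morphism.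
HB.instance Definition _ := GRing.isZmodMorphism.Build (eR idem) L
  (@eR_val L idem) eR_val_is_zmod_morphism.
HB.instance Definition _ := GRing.isZmodMorphism.Build (corner idem) L
  (@corner_val L idem) corner_val_is_zmod_morphism.
HB.instance Definition _ := GRing.isZmodMorphism.Build (ReR idem) L
  (@ReR_val L idem) ReR_val_is_zmod_morphism.

Lemma Re_val_mul (x : Re idem) : Re_val x * e = Re_val x.
Proof. exact/eqP/(Re_valP x). Qed.
Lemma mul_eR_val (y : eR idem) : e * eR_val y = eR_val y.
Proof. exact/eqP/(eR_valP y). Qed.
Lemma corner_val_mul (c : corner idem) : corner_val c * e = corner_val c.
Proof.
by case: c => c /= /corner_predP[r ->]; rewrite -!mulrA (idem_valP idem).
Qed.
Lemma mul_corner_val (c : corner idem) : e * corner_val c = corner_val c.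
Proof.
by case: c => c /= /corner_predP[r ->]; rewrite !mulrA (idem_valP idem).
Qed.

Lemma ReR_mulE (x : Re idem) (y : eR idem) :
  ReR_val (ReR_mul (x ⊗ y)) = Re_val x * eR_val y.
Proof. by rewrite /ReR_mul tensor_liftE. Qed.

Lemma ReR_mul_is_zmod_morphism : zmod_morphism (@ReR_mul L idem).
Proof. exact: tensor_lift_is_zmod_morphism. Qed.

Lemma ReR_mul_surj (z : ReR idem) : exists t, ReR_mul t = z.
Proof.
case: z => z zP; have /asboolP[r zE] := zP.
suff [t tE] : exists t, ReR_val (@ReR_mul L idem t) = z.
  by exists t; apply: val_inj.
rewrite {}zE; elim: r => [|[x y] r [t tE]].
  exists 0; rewrite big_nil.
  by rewrite (zmod_morphism0 ReR_mul_is_zmod_morphism).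
(* Since [e] is idempotent, [x e y] is the product of [x e] and [e y]. *)
exists (Re_proj x ⊗ eR_proj y + t).
rewrite (zmod_morphismD ReR_mul_is_zmod_morphism) raddfD /= tE big_cons ReR_mulE /=.
by rewrite !mulrA -(mulrA x) (idem_valP idem).
Qed.

End CornerProjections.

(** * The stratifying criterion for a Peirce decomposition *)

Section Peirce.
Variables (L A : pzRingType) (B : zmodType) (M : rmodType A) (N : lmodType A).
Variables (idem : idempotent_elt L) (phi : {additive tensor M N -> B}).
Variables (ca : {additive A -> L}) (cm : {additive M -> L}).
Variables (cn : {additive N -> L}) (cb : {additive B -> L}).
Variables (pa : {additive L -> A}) (pm : {additive L -> M}).
Variable (pn : {additive L -> N}).
Local Notation e := (idem_val idem).

(* [A], [M], [N] are identified with the components [eLe], [(1-e)Le], [eL(1-e)]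
   of the Peirce decomposition of [L], and [B] with part of [(1-e)L(1-e)]. *)
Record peirce_frame : Prop := PeirceFrame {
  peirce1 : ca 1 = e;
  peirceAA : forall a a', ca a * ca a' = ca (a * a');
  peirceAN : forall a n, ca a * cn n = cn (a *: n);
  peirceMA : forall m a, cm m * ca a = cm (m *< a);
  peirceMN : forall m n, cm m * cn n = cb (phi (m ⊗ n));
  peirceKa : forall a, pa (ca a) = a;
  peirceKm : forall m, pm (cm m) = m;
  peirceKn : forall n, pn (cn n) = n;
  peirce_pm_ca : forall a, pm (ca a) = 0;
  peirce_pn_ca : forall a, pn (ca a) = 0;
  peirce_pa_cm : forall m, pa (cm m) = 0;
  peirce_pn_cm : forall m, pn (cm m) = 0;
  peirce_pa_cn : forall n, pa (cn n) = 0;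
  peirce_pm_cn : forall n, pm (cn n) = 0;
  peirce_mulel : forall l, e * l = ca (pa l) + cn (pn l);
  peirce_mulle : forall l, l * e = ca (pa l) + cm (pm l);
  peirce_cb_inj : injective cb
}.

Hypothesis H : peirce_frame.

Lemma peirce_e_ca a : e * ca a = ca a.
Proof. by rewrite (peirce_mulel H) (peirceKa H) (peirce_pn_ca H) raddf0 addr0. Qed.
Lemma peirce_ca_e a : ca a * e = ca a.
Proof. by rewrite (peirce_mulle H) (peirceKa H) (peirce_pm_ca H) raddf0 addr0. Qed.
Lemma peirce_e_cm m : e * cm m = 0.
Proof. by rewrite (peirce_mulel H) (peirce_pa_cm H) (peirce_pn_cm H) !raddf0 addr0. Qed.
Lemma peirce_cm_e m : cm m * e = cm m.
Proof. by rewrite (peirce_mulle H) (peirce_pa_cm H) (peirceKm H) raddf0 add0r. Qed.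
Lemma peirce_e_cn n : e * cn n = cn n.
Proof. by rewrite (peirce_mulel H) (peirce_pa_cn H) (peirceKn H) raddf0 add0r. Qed.
Lemma peirce_cn_e n : cn n * e = 0.
Proof. by rewrite (peirce_mulle H) (peirce_pa_cn H) (peirce_pm_cn H) !raddf0 addr0. Qed.

Lemma Re_valE (x : Re idem) : Re_val x = ca (pa (Re_val x)) + cm (pm (Re_val x)).
Proof. by rewrite -{1}Re_val_mul (peirce_mulle H). Qed.
Lemma eR_valE (y : eR idem) : eR_val y = ca (pa (eR_val y)) + cn (pn (eR_val y)).
Proof. by rewrite -{1}mul_eR_val (peirce_mulel H). Qed.
Lemma corner_valE (c : corner idem) : corner_val c = ca (pa (corner_val c)).
Proof.
rewrite -{1}corner_val_mul -{1}mul_corner_val (peirce_mulel H) mulrDl.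
by rewrite peirce_ca_e peirce_cn_e addr0.
Qed.

(** Multiplying by [e] on both sides makes membership in the corner automatic and leaves [ca a]
    unchanged. *)
Definition to_corner a : corner idem := corner_proj idem (ca a).
Definition of_corner (c : corner idem) : A := pa (corner_val c).

Lemma to_cornerE a : corner_val (to_corner a) = ca a.
Proof. by rewrite /= peirce_e_ca peirce_ca_e. Qed.

Lemma to_cornerK : cancel to_corner of_corner.
Proof. by move=> a; rewrite /of_corner to_cornerE (peirceKa H). Qed.
Lemma of_cornerK : cancel of_corner to_corner.
Proof. by move=> c; apply: val_inj; rewrite [LHS]to_cornerE -corner_valE. Qed.

Fact to_corner_is_zmod_morphism : zmod_morphism to_corner.
Proof. by move=> a a'; rewrite /to_corner !raddfB. Qed.
Fact to_corner_is_monoid_morphism : monoid_morphism to_corner.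
Proof.
split=> [|a a']; apply: val_inj; first by rewrite [LHS]to_cornerE (peirce1 H).
by rewrite /= -!/(corner_val _) !peirce_e_ca !peirce_ca_e (peirceAA H).
Qed.
HB.instance Definition _ := GRing.isZmodMorphism.Build A (corner idem)
  to_corner to_corner_is_zmod_morphism.
HB.instance Definition _ := GRing.isMonoidMorphism.Build A (corner idem)
  to_corner to_corner_is_monoid_morphism.

Fact of_corner_is_zmod_morphism : zmod_morphism of_corner.
Proof. by move=> c c'; rewrite /of_corner !raddfB. Qed.
Fact of_corner_is_monoid_morphism : monoid_morphism of_corner.
Proof.
split=> [|c c']; apply: (can_inj to_cornerK).
  by rewrite of_cornerK rmorph1.
by rewrite rmorphM /= !of_cornerK.
Qed.
HB.instance Definition _ := GRing.isZmodMorphism.Build (corner idem) A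
  of_corner of_corner_is_zmod_morphism.
HB.instance Definition _ := GRing.isMonoidMorphism.Build (corner idem) A
  of_corner of_corner_is_monoid_morphism.

Definition M_to_Re m : Re idem := Re_proj idem (cm m).
Definition Re_to_M (x : Re idem) : M := pm (Re_val x).
Definition N_to_eR n : eR idem := eR_proj idem (cn n).
Definition eR_to_N (y : eR idem) : N := pn (eR_val y).

Lemma M_to_ReE m : Re_val (M_to_Re m) = cm m.
Proof. exact: peirce_cm_e. Qed.
Lemma N_to_eRE n : eR_val (N_to_eR n) = cn n.
Proof. exact: peirce_e_cn. Qed.
Lemma M_to_ReK : cancel M_to_Re Re_to_M.
Proof. by move=> m; rewrite /Re_to_M M_to_ReE (peirceKm H). Qed.
Lemma N_to_eRK : cancel N_to_eR eR_to_N.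
Proof. by move=> n; rewrite /eR_to_N N_to_eRE (peirceKn H). Qed.

Lemma M_to_Re_semilinear : semilinear_ract to_corner M_to_Re.
Proof.
split=> [m m'|m a]; first by rewrite /M_to_Re !raddfB.
apply: val_inj; rewrite [LHS]M_to_ReE -(peirceMA H) -M_to_ReE -to_cornerE.
by [].
Qed.

Lemma N_to_eR_semilinear : semilinear_lact to_corner N_to_eR.
Proof.
split=> [n n'|a n]; first by rewrite /N_to_eR !raddfB.
apply: val_inj; rewrite [LHS]N_to_eRE -(peirceAN H) -N_to_eRE -to_cornerE.
by [].
Qed.

Lemma Re_to_M_semilinear : semilinear_ract of_corner Re_to_M.
Proof.
split=> [x x'|x c]; first by rewrite /Re_to_M !raddfB.
rewrite /Re_to_M /= {1}Re_valE corner_valE mulrDl (peirceAA H) (peirceMA H).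
by rewrite raddfD (peirce_pm_ca H) (peirceKm H) add0r.
Qed.

Lemma eR_to_N_semilinear : semilinear_lact of_corner eR_to_N.
Proof.
split=> [y y'|c y]; first by rewrite /eR_to_N !raddfB.
rewrite /eR_to_N /= {1}eR_valE corner_valE mulrDr (peirceAA H) (peirceAN H).
by rewrite raddfD (peirce_pn_ca H) (peirceKn H) add0r.
Qed.

(** For [x] in [Le] the [A]-part is [e x]. Writing it as the generator [e] times the corner element
    [e x e] shows that it factors through a free module of rank one, and gives it the shape used in
    [tens_decomp]. *)
Lemma Re_to_MK (x : Re idem) :
  M_to_Re (Re_to_M x) = x - Re_proj idem e *< corner_proj idem (Re_val x).
Proof.
apply: val_inj; rewrite [LHS]M_to_ReE raddfB /=.
rewrite !mulrA !(idem_valP idem) -mulrA Re_val_mul /Re_to_M.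
by rewrite [X in e * X]Re_valE mulrDr peirce_e_ca peirce_e_cm addr0
  [X in X - _]Re_valE addrAC subrr add0r.
Qed.

Lemma eR_to_NK (y : eR idem) :
  N_to_eR (eR_to_N y) = y - corner_proj idem (eR_val y) *: eR_proj idem e.
Proof.
apply: val_inj; rewrite [LHS]N_to_eRE raddfB /=.
rewrite mul_eR_val -!mulrA !(idem_valP idem) /eR_to_N.
by rewrite [X in X * e]eR_valE mulrDl peirce_ca_e peirce_cn_e addr0
  [X in X - _]eR_valE addrAC subrr add0r.
Qed.

Lemma Re_stable_retract : stable_retract to_corner of_corner M (Re idem).
Proof.
exists Re_to_M, M_to_Re, unit.
(* The error of the retraction is minus the [A]-part: send [x] to the coefficient [- e x e] in the
   free module on one generator, then that generator to [e]. *)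
exists (fun x => << - corner_proj idem (Re_val x) *g tt >>).
exists (free_lift idfun (fun=> Re_proj idem e)).
split.
- exact: Re_to_M_semilinear.
- exact: M_to_Re_semilinear.
- split=> [x x'|x c]; first by rewrite -monalgUB !raddfB.
  rewrite free_ractU mulNr; congr (<< - _ *g tt >>); apply: val_inj.
  by rewrite /= -!mulrA corner_val_mul mul_corner_val.
- exact: free_lift_semilinear.
- by move=> x; rewrite free_liftU raddfN /= Re_to_MK.
Qed.

Lemma M_stable_retract : stable_retract of_corner to_corner (Re idem) M.
Proof.
exists M_to_Re, Re_to_M, unit, (fun=> 0), (fun=> 0); split.
- exact: M_to_Re_semilinear.
- exact: Re_to_M_semilinear.
- by split=> [x y|x a]; rewrite ?subrr ?ract0r.
- by split=> [x y|x a]; rewrite ?subrr ?ract0r.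
- by move=> m; rewrite M_to_ReK addr0.
Qed.

(** [M] and [N] are honest retracts of [Le] and [eL], so the error terms are zero in one direction;
    in the other, both errors are minus the [A]-part. *)
Lemma peirce_Tor_trivial :
  (forall i, (0 < i)%N -> trivial_zmod (Tor (Re idem) (eR idem) i)) <->
  (forall i, (0 < i)%N -> trivial_zmod (Tor M N i)).
Proof.
split.
  apply: (stable_retract_Tor_trivial (s := of_corner) (t := to_corner) to_cornerK
    (j := N_to_eR) (p := eR_to_N) (chi := fun=> 0) (w := 0)).
  - exact: M_stable_retract.
  - exact: N_to_eR_semilinear.
  - exact: eR_to_N_semilinear.
  - by move=> x y; rewrite subrr.
  - by move=> *; rewrite mulr0.
  - by move=> n; rewrite N_to_eRK scaler0 addr0.
(* By [eR_to_NK], passing from [eL] to [N] and back subtracts [e y e] times the generator [e]; this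
   dictates [chi] and [w]. *)
apply: (stable_retract_Tor_trivial (s := to_corner) (t := of_corner) of_cornerK
  (j := eR_to_N) (p := N_to_eR) (chi := fun y => - corner_proj idem (eR_val y))
  (w := eR_proj idem e)).
- exact: Re_stable_retract.
- exact: eR_to_N_semilinear.
- exact: N_to_eR_semilinear.
- by move=> y y'; rewrite !raddfB.
- move=> c y; rewrite mulrN; congr (- _); apply: val_inj.
  by rewrite /= !mulrA mul_corner_val corner_val_mul.
- by move=> y; rewrite scaleNr eR_to_NK.
Qed.

(* Up to terms determined by its product, a tensor in [Le ⊗ eL] comes from
   [M ⊗ N], where the product is [phi]. *)
Lemma peirce_mul_injective : injective (@ReR_mul L idem) <-> injective phi.
Proof.
have MNbal := semilinear_balanced M_to_Re_semilinear N_to_eR_semilinear.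
have pbal := semilinear_balanced Re_to_M_semilinear eR_to_N_semilinear.
have mulB := @ReR_mul_is_zmod_morphism L idem.
have mulMN s : ReR_val (ReR_mul (tensor_lift MNbal s)) = cb (phi s).
  apply: (tensor_ext (f := fun s => ReR_val (ReR_mul (tensor_lift MNbal s)))
    (g := fun s => cb (phi s))) => [x y|x y|m n].
  - by rewrite raddfB mulB raddfB.
  - by rewrite !raddfB.
  - by rewrite tensor_liftE ReR_mulE M_to_ReE N_to_eRE (peirceMN H).
pose mu t := ReR_val (@ReR_mul L idem t).
have muB : zmod_morphism mu by move=> x y; rewrite /mu mulB raddfB.
have muE x y : mu (x ⊗ y) = Re_val x * eR_val y by exact: ReR_mulE.
(* The component of the product in [(1-e)L]. *)
pose q t := mu t - e * mu t.
have qB : zmod_morphism q.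
  by move=> x y; rewrite /q muB mulrBr !opprD addrACA.
(* On [x ⊗ y] this is [tens_decomp] with both base elements equal to [e] and with coefficients
   [e x e] and [e y e]. The first two terms can be rewritten through the product [x y] alone, so the
   formula makes sense for every tensor. *)
have tE t : t = Re_proj idem e ⊗ eR_proj idem (mu t)
    + Re_proj idem (q t) ⊗ eR_proj idem e
    + tensor_lift MNbal (tensor_lift pbal t).
  apply: (tensor_ext (f := id) (g := fun t =>
    Re_proj idem e ⊗ eR_proj idem (mu t)
    + Re_proj idem (q t) ⊗ eR_proj idem e
    + tensor_lift MNbal (tensor_lift pbal t))) => // [x y|x y].
    rewrite muB qB (raddfB (eR_proj idem)) (raddfB (Re_proj idem)).
    rewrite (raddfB (tensor_lift pbal)) (raddfB (tensor_lift MNbal)) tensBr tensBl.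
    by rewrite !opprD [RHS]addrACA; congr (_ + _); rewrite addrACA.
  rewrite !tensor_liftE /q muE Re_to_MK eR_to_NK.
  set x1 := _ *< _; set y1 := _ *: _.
  have -> : eR_proj idem (Re_val x * eR_val y) = corner_proj idem (Re_val x) *: y.
    by apply: val_inj; rewrite /= -!mulrA mul_eR_val.
  have -> : Re_proj idem (Re_val x * eR_val y - e * (Re_val x * eR_val y))
      = (x - x1) *< corner_proj idem (eR_val y).
    apply: val_inj; rewrite /= mul_eR_val !mulrA !(idem_valP idem).
    by rewrite -(mulrA e _ e) Re_val_mul -mulrBl.
  exact: tens_decomp.
split=> inj; apply: zmod_morphism_injective => //.
- exact: raddfB.
(* The map from [M ⊗ N] is split by [pbal], so it is enough that the image of [s] is zero; its
   product is [cb (phi s) = 0]. *)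
- move=> s s0; suff lift0 : tensor_lift MNbal s = 0.
    rewrite -(raddf0 (tensor_lift pbal)) -lift0.
    apply: (tensor_ext (f := id) (g := fun s =>
      tensor_lift pbal (tensor_lift MNbal s))) => // [x y|m n].
      by rewrite !raddfB.
    by rewrite !tensor_liftE M_to_ReK N_to_eRK.
  apply: inj; apply: val_inj; rewrite (zmod_morphism0 mulB) [LHS]mulMN s0.
  by rewrite raddf0.
- move=> t t0; have mut : mu t = 0 by rewrite /mu t0 raddf0.
  have tlift : t = tensor_lift MNbal (tensor_lift pbal t).
    rewrite {1}[t]tE /q mut mulr0 subrr !raddf0 tens0l tens0r.
    by rewrite !add0r.
  rewrite tlift; suff -> : tensor_lift pbal t = 0 by rewrite raddf0.
  apply: inj; apply: (peirce_cb_inj H).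
  by rewrite -mulMN -tlift -/(mu t) mut !raddf0.
Qed.

(** Multiplication onto [LeL] is always surjective, so its bijectivity reduces to injectivity. *)
Lemma peirce_stratifying :
  stratifying idem <->
  injective phi /\ forall i, (0 < i)%N -> trivial_zmod (Tor M N i).
Proof.
rewrite /stratifying peirce_Tor_trivial -peirce_mul_injective.
split=> -[bij tor]; split=> //; first exact: bij_inj.
exact: inj_surj_bijective bij (@ReR_mul_surj L idem).
Qed.

End Peirce.

(** * The Peirce frames of the Morita ring *)

Section MoritaEntries.
Variables (A B : pzRingType) (N : bimodType A B) (M : bimodType B A).
Variables (phi : tensor M N -> B^o) (psi : tensor N M -> A^o).
Variable C : morita_context phi psi.
Local Notation L := (morita_ring C).
Local Notation Mx := (@MoritaMx A B N M phi psi C).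

Definition morita_in_a (a : A) : L := Mx a 0 0 0.
Definition morita_in_n (n : N) : L := Mx 0 n 0 0.
Definition morita_in_m (m : M) : L := Mx 0 0 m 0.
Definition morita_in_b (b : B) : L := Mx 0 0 0 b.

Fact mor_a_is_zmod_morphism : zmod_morphism (@mor_a A B N M phi psi C).
Proof. by []. Qed.
Fact mor_n_is_zmod_morphism : zmod_morphism (@mor_n A B N M phi psi C).
Proof. by []. Qed.
Fact mor_m_is_zmod_morphism : zmod_morphism (@mor_m A B N M phi psi C).
Proof. by []. Qed.
Fact mor_b_is_zmod_morphism : zmod_morphism (@mor_b A B N M phi psi C).
Proof. by []. Qed.
Fact morita_in_a_is_zmod_morphism : zmod_morphism morita_in_a.
Proof. by move=> x y; congr MoritaMx; rewrite /= subrr. Qed.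
Fact morita_in_n_is_zmod_morphism : zmod_morphism morita_in_n.
Proof. by move=> x y; congr MoritaMx; rewrite /= subrr. Qed.
Fact morita_in_m_is_zmod_morphism : zmod_morphism morita_in_m.
Proof. by move=> x y; congr MoritaMx; rewrite /= subrr. Qed.
Fact morita_in_b_is_zmod_morphism : zmod_morphism morita_in_b.
Proof. by move=> x y; congr MoritaMx; rewrite /= subrr. Qed.
Fact phi_is_zmod_morphism : zmod_morphism phi.
Proof. by case: (phi_hom C). Qed.
Fact psi_is_zmod_morphism : zmod_morphism psi.
Proof. by case: (psi_hom C). Qed.

HB.instance Definition _ := GRing.isZmodMorphism.Build L A
  (@mor_a A B N M phi psi C) mor_a_is_zmod_morphism.
HB.instance Definition _ := GRing.isZmodMorphism.Build L N
  (@mor_n A B N M phi psi C) mor_n_is_zmod_morphism.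
HB.instance Definition _ := GRing.isZmodMorphism.Build L M
  (@mor_m A B N M phi psi C) mor_m_is_zmod_morphism.
HB.instance Definition _ := GRing.isZmodMorphism.Build L B
  (@mor_b A B N M phi psi C) mor_b_is_zmod_morphism.
HB.instance Definition _ := GRing.isZmodMorphism.Build A L
  morita_in_a morita_in_a_is_zmod_morphism.
HB.instance Definition _ := GRing.isZmodMorphism.Build N L
  morita_in_n morita_in_n_is_zmod_morphism.
HB.instance Definition _ := GRing.isZmodMorphism.Build M L
  morita_in_m morita_in_m_is_zmod_morphism.
HB.instance Definition _ := GRing.isZmodMorphism.Build B L
  morita_in_b morita_in_b_is_zmod_morphism.

(** Additivity of [phi] comes from the context [C], so the bundled map is packed by hand. *)
Definition phi_additive : {additive tensor M N -> B^o} :=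
  HB.pack phi (GRing.isZmodMorphism.Build _ _ phi phi_is_zmod_morphism).
Definition psi_additive : {additive tensor N M -> A^o} :=
  HB.pack psi (GRing.isZmodMorphism.Build _ _ psi psi_is_zmod_morphism).

Lemma phi0 : phi 0 = 0.
Proof. exact: zmod_morphism0 phi_is_zmod_morphism. Qed.
Lemma psi0 : psi 0 = 0.
Proof. exact: zmod_morphism0 psi_is_zmod_morphism. Qed.

Local Ltac morita_entries := by move=> *; congr MoritaMx;
  rewrite /= !(tens0l, tens0r, phi0, psi0, mulr0, mul0r, scaler0, scale0r,
    ractr0, ract0r, mulr1, mul1r, ractr1, scale1r, addr0, add0r).

(** The multiplication rules hold entry by entry once products with a zero factor are removed;
    injectivity of [morita_in_b] is read off the lower right entry. *)
Lemma morita_e_peirce : peirce_frame (morita_e C) phi_additive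
  morita_in_a morita_in_m morita_in_n morita_in_b
  (@mor_a A B N M phi psi C) (@mor_m A B N M phi psi C)
  (@mor_n A B N M phi psi C).
Proof.
split=> //; try morita_entries.
by move=> b b' [].
Qed.

Lemma morita_f_peirce : peirce_frame (morita_f C) psi_additive
  morita_in_b morita_in_n morita_in_m morita_in_a
  (@mor_b A B N M phi psi C) (@mor_n A B N M phi psi C)
  (@mor_m A B N M phi psi C).
Proof.
split=> //; try morita_entries.
by move=> a a' [].
Qed.

End MoritaEntries.

Theorem proposition4p1 (A B : pzRingType)
    (N : bimodType A B) (M : bimodType B A)
    (phi : tensor M N -> B^o) (psi : tensor N M -> A^o)
    (C : morita_context phi psi) :
  (stratifying (morita_e C) <->
     injective phi /\ forall i, (0 < i)%N -> trivial_zmod (Tor M N i))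
  /\
  (stratifying (morita_f C) <->
     injective psi /\ forall i, (0 < i)%N -> trivial_zmod (Tor N M i)).
Proof.
split.
- exact: peirce_stratifying (morita_e_peirce C).
- exact: peirce_stratifying (morita_f_peirce C).
Qed.
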